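(* Let $1\le q\le p<\infty$, let $X,Y$ be Banach lattices and $E,F$ Banach spaces. (1) A bounded linear $T:X\to F$ is left positive Cohen $(p,q)$-nuclear if and only if $T^{\ast}:F^{\ast}\to X^{\ast}$ is right positive Cohen $(q^{\ast},p^{\ast})$-nuclear; moreover $\|T\|_{\mathcal{CN}^{left,+}_{p,q}}=\|T^{\ast}\|_{\mathcal{CN}^{right,+}_{q^{\ast},p^{\ast}}}$. (2) A bounded linear $T:E\to Y$ is right positive Cohen $(p,q)$-nuclear if and only if $T^{\ast}:Y^{\ast}\to E^{\ast}$ is left positive Cohen $(q^{\ast},p^{\ast})$-nuclear; moreover $\|T\|_{\mathcal{CN}^{right,+}_{p,q}}=\|T^{\ast}\|_{\mathcal{CN}^{left,+}_{q^{\ast},p^{\ast}}}$. (3) A bounded linear $T:X\to Y$ is positive Cohen $(p,q)$-nuclear if and only if $T^{\ast}:Y^{\ast}\to X^{\ast}$ is positive Cohen $(q^{\ast},p^{\ast})$-nuclear; moreover $\|T\|_{\mathcal{CN}^{+}_{p,q}}=\|T^{\ast}\|_{\mathcal{CN}^{+}_{q^{\ast},p^{\ast}}}$.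
   Context: $r^{\ast}$ denotes the conjugate exponent of $r$; duals of Banach lattices are Banach lattices. For a Banach space $G$: $\|(x_i)\|_{r,\omega}=\sup_{x^{\ast}\in B_{G^{\ast}}}\|(\langle x_i,x^{\ast}\rangle)_i\|_r$; $\ell_r\langle G\rangle$ (Cohen strongly $r$-summable sequences) has norm $\|(x_i)\|_{\ell_r\langle G\rangle}=\sup\{|\sum_i x_i^{\ast}(x_i)|:\|(x_i^{\ast})\|_{r^{\ast},\omega}\le1\}$. For a Banach lattice $Z$: $\|(z_i)\|_{r,|\omega|}=\sup_{z^{\ast}\in B_{Z^{\ast}}\cap Z^{\ast}_+}(\sum_i\langle z^{\ast},|z_i|\rangle^{r})^{1/r}$ (with the usual modification for $r=\infty$); $\ell_r^{\pi}(Z)$ for $1<r\le\infty$ has norm $\|(z_i)\|_{\ell_r^{\pi}(Z)}=\sup\sum_i\langle z_i^{\ast},|z_i|\rangle$ over positive $(z_i^{\ast})$ in $Z^{\ast}$ with $\sup_{z\in B_Z\cap Z_+}\|(\langle|z_i^{\ast}|,z\rangle)_i\|_{r^{\ast}}\le1$, and $\ell_1^{\pi}(Z)=\ell_1(Z)$ by convention. For Banach lattice $Z$, Banach lattice $W$, Banach spaces $G,H$ and exponents $p,q$ (all inequalities for all finite families, $C$ independent): $S:Z\to H$ is left positive Cohen $(p,q)$-nuclear if $\|(S(z_i))\|_{\ell_p\langle H\rangle}\le C\|(z_i)\|_{q,|\omega|}$; $S:G\to W$ is right positive Cohen $(p,q)$-nuclear if $\|(S(x_i))\|_{\ell_p^{\pi}(W)}\le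 C\|(x_i)\|_{q,\omega}$; $S:Z\to W$ is positive Cohen $(p,q)$-nuclear if $\|(S(z_i))\|_{\ell_p^{\pi}(W)}\le C\|(z_i)\|_{q,|\omega|}$. In each case the corresponding norm $\|S\|_{\mathcal{CN}^{left,+}_{p,q}}$, $\|S\|_{\mathcal{CN}^{right,+}_{p,q}}$, $\|S\|_{\mathcal{CN}^{+}_{p,q}}$ is the infimum of such $C$. *)

(* Defs.v *)
From HB Require Import structures.
From mathcomp Require Import all_boot all_order all_algebra.
From mathcomp Require Import all_classical all_reals all_analysis.
Import Order.TTheory GRing.Theory Num.Theory.
Import numFieldNormedType.Exports.
Local Open Scope classical_set_scope.
Local Open Scope ring_scope.

(* Real normed spaces are represented by "space data": a carrier type, a
   membership predicate carving the actual space out of the carrier, the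
   vector operations and the norm.  This lets us build the (topological)
   dual of a space as the set of bounded linear functionals, with its dual
   norm, and iterate this construction (biduals are needed by the
   definitions).  Banach lattices additionally carry their order and
   modulus; the dual of a Banach lattice is given its dual order and the
   Riesz--Kantorovich modulus. *)

Record nspace (R : realType) := NSpace {
  ns_car : Type;
  ns_mem : ns_car -> Prop;
  ns_zero : ns_car;
  ns_add : ns_car -> ns_car -> ns_car;
  ns_scale : R -> ns_car -> ns_car;
  ns_norm : ns_car -> R }.

Record nlattice (R : realType) := NLattice {
  nl_sp :> nspace R;
  nl_le : ns_car R nl_sp -> ns_car R nl_sp -> Prop;
  nl_abs : ns_car R nl_sp -> ns_car R nl_sp }.

Record lat_data (V : Type) := LatData { ld_le : V -> V -> Prop; ld_abs : V -> V }.

Arguments ns_car {R}. Arguments ns_mem {R}. Arguments ns_zero {R}.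
Arguments ns_add {R}. Arguments ns_scale {R}. Arguments ns_norm {R}.
Arguments nl_sp {R}. Arguments nl_le {R}. Arguments nl_abs {R}.
Arguments LatData {V}. Arguments ld_le {V}. Arguments ld_abs {V}.

Section Defs.
Local Set Implicit Arguments.
Variable R : realType.

Definition lin_on (S : nspace R) (f : ns_car S -> R) : Prop :=
  forall (a : R) x y, ns_mem S x -> ns_mem S y ->
    f (ns_add S (ns_scale S a x) y) = a * f x + f y.

Definition bdd_on (S : nspace R) (f : ns_car S -> R) : Prop :=
  exists c : R, forall x, ns_mem S x -> `|f x| <= c * ns_norm S x.

Definition dual_norm (S : nspace R) (f : ns_car S -> R) : R :=
  sup [set `|f x| | x in [set x | ns_mem S x /\ ns_norm S x <= 1]].

Definition dual (S : nspace R) : nspace R :=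
  {| ns_car := ns_car S -> R;
     ns_mem := fun f => lin_on S f /\ bdd_on S f;
     ns_zero := fun _ => 0;
     ns_add := fun f g x => f x + g x;
     ns_scale := fun a f x => a * f x;
     ns_norm := dual_norm S |}.

Definition ev (S : nspace R) (f : ns_car (dual S)) (x : ns_car S) : R := f x.

Definition nl_pos (Z : nlattice R) (x : ns_car Z) : Prop := nl_le Z (ns_zero Z) x.
Definition nl_sub (Z : nlattice R) (x y : ns_car Z) : ns_car Z :=
  ns_add Z x (ns_scale Z (-1) y).
Definition ppart (Z : nlattice R) (x : ns_car Z) : ns_car Z :=
  ns_scale Z (2^-1) (ns_add Z (nl_abs Z x) x).
Definition npart (Z : nlattice R) (x : ns_car Z) : ns_car Z :=
  ns_scale Z (2^-1) (nl_sub Z (nl_abs Z x) x).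

(* Riesz--Kantorovich: |f|(u) = sup { f y : |y| <= u } for u >= 0 *)
Definition rk_sup (Z : nlattice R) (f : ns_car Z -> R) (u : ns_car Z) : R :=
  sup [set f y | y in [set y | ns_mem Z y /\ nl_le Z (nl_abs Z y) u]].

Definition dual_abs (Z : nlattice R) (f : ns_car Z -> R) : ns_car Z -> R :=
  fun x => rk_sup Z f (ppart Z x) - rk_sup Z f (npart Z x).

Definition dual_le (Z : nlattice R) (f g : ns_car Z -> R) : Prop :=
  forall x, ns_mem Z x -> nl_pos Z x -> f x <= g x.

Definition dualL (Z : nlattice R) : nlattice R :=
  {| nl_sp := dual Z; nl_le := dual_le Z; nl_abs := dual_abs Z |}.

Definition adjoint (A B : nspace R) (T : ns_car A -> ns_car B) :
  ns_car (dual B) -> ns_car (dual A) := fun f x => f (T x).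

Definition ns_of (V : normedModType R) : nspace R :=
  {| ns_car := V; ns_mem := fun _ => True; ns_zero := 0;
     ns_add := fun x y => x + y; ns_scale := fun a x => a *: x;
     ns_norm := fun x => `|x| |}.

Definition nl_of (V : normedModType R) (L : lat_data V) : nlattice R :=
  {| nl_sp := ns_of V; nl_le := ld_le L; nl_abs := ld_abs L |}.

Definition is_banach_lattice (V : completeNormedModType R) (L : lat_data V) : Prop :=
  let le := ld_le L in
  [/\ (forall x, le x x),
      (forall x y, le x y -> le y x -> x = y),
      (forall x y z, le x y -> le y z -> le x z),
      (forall x y z, le x y -> le (x + z) (y + z)) &
      (forall (a : R) x y, 0 <= a -> le x y -> le (a *: x) (a *: y))] /\
  [/\ (forall x y, exists s, [/\ le x s, le y s &
                                 forall u, le x u -> le y u -> le s u]),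
      (forall x, [/\ le x (ld_abs L x), le (- x) (ld_abs L x) &
                     forall u, le x u -> le (- x) u -> le (ld_abs L x) u]) &
      (forall x y, le (ld_abs L x) (ld_abs L y) -> `|x| <= `|y|)].

Definition lnorm (r : \bar R) (n : nat) (a : 'I_n -> R) : R :=
  match r with
  | (+oo)%E => \big[Num.max/0]_(i < n) `|a i|
  | EFin x => (\sum_(i < n) (`|a i| `^ x)) `^ x^-1
  | (-oo)%E => 0
  end.

Definition conj_exp (r : \bar R) : \bar R :=
  match r with
  | EFin x => if x == 1 then (+oo)%E else (x / (x - 1))%:E
  | (+oo)%E => 1%E
  | (-oo)%E => (-oo)%E
  end.

Local Open Scope ereal_scope.

Definition weak_norm (G : nspace R) (r : \bar R) (n : nat)
    (x : 'I_n -> ns_car G) : \bar R :=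
  ereal_sup [set (lnorm r (fun i => ev f (x i)))%:E
            | f in [set f | ns_mem (dual G) f /\ (ns_norm (dual G) f <= 1)%R]].

Definition cohen_norm (G : nspace R) (r : \bar R) (n : nat)
    (x : 'I_n -> ns_car G) : \bar R :=
  ereal_sup [set (`| \sum_(i < n) ev (fs i) (x i) |)%:E
            | fs in [set fs : 'I_n -> ns_car (dual G) |
                     (forall i, ns_mem (dual G) (fs i)) /\
                     weak_norm (dual G) (conj_exp r) fs <= 1]].

Definition abs_weak_norm (Z : nlattice R) (r : \bar R) (n : nat)
    (z : 'I_n -> ns_car Z) : \bar R :=
  ereal_sup [set (lnorm r (fun i => ev f (nl_abs Z (z i))))%:E
            | f in [set f | [/\ ns_mem (dual Z) f, (ns_norm (dual Z) f <= 1)%R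
                              & nl_pos (dualL Z) f]]].

(* ||(z_i)||_{l_r^pi(Z)}; for r = 1 this is l_1(Z) by convention *)
Definition pi_norm (Z : nlattice R) (r : \bar R) (n : nat)
    (z : 'I_n -> ns_car Z) : \bar R :=
  if r == 1 then (\sum_(i < n) ns_norm Z (z i))%:E
  else ereal_sup
    [set (\sum_(i < n) ev (fs i) (nl_abs Z (z i)))%:E
    | fs in [set fs : 'I_n -> ns_car (dual Z) |
             (forall i, ns_mem (dual Z) (fs i) /\ nl_pos (dualL Z) (fs i)) /\
             ereal_sup [set (lnorm (conj_exp r)
                               (fun i => ev (nl_abs (dualL Z) (fs i)) y))%:E
                       | y in [set y | [/\ ns_mem Z y, (ns_norm Z y <= 1)%R
                                        & nl_pos Z y]]] <= 1]].

Definition left_pos_ineq (Z : nlattice R) (H : nspace R) (p q : \bar R)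
    (S : ns_car Z -> ns_car H) (C : R) : Prop :=
  forall n (z : 'I_n -> ns_car Z), (forall i, ns_mem Z (z i)) ->
    cohen_norm H p (fun i => S (z i)) <= C%:E * abs_weak_norm Z q z.

Definition right_pos_ineq (G : nspace R) (W : nlattice R) (p q : \bar R)
    (S : ns_car G -> ns_car W) (C : R) : Prop :=
  forall n (x : 'I_n -> ns_car G), (forall i, ns_mem G (x i)) ->
    pi_norm W p (fun i => S (x i)) <= C%:E * weak_norm G q x.

Definition pos_ineq (Z W : nlattice R) (p q : \bar R)
    (S : ns_car Z -> ns_car W) (C : R) : Prop :=
  forall n (z : 'I_n -> ns_car Z), (forall i, ns_mem Z (z i)) ->
    pi_norm W p (fun i => S (z i)) <= C%:E * abs_weak_norm Z q z.

Definition left_pos_cohen Z H p q S := exists C, @left_pos_ineq Z H p q S C.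
Definition right_pos_cohen G W p q S := exists C, @right_pos_ineq G W p q S C.
Definition pos_cohen Z W p q S := exists C, @pos_ineq Z W p q S C.

Definition left_pos_cohen_norm Z H p q S : \bar R :=
  ereal_inf [set C%:E | C in [set C | (0 <= C)%R /\ @left_pos_ineq Z H p q S C]].
Definition right_pos_cohen_norm G W p q S : \bar R :=
  ereal_inf [set C%:E | C in [set C | (0 <= C)%R /\ @right_pos_ineq G W p q S C]].
Definition pos_cohen_norm Z W p q S : \bar R :=
  ereal_inf [set C%:E | C in [set C | (0 <= C)%R /\ @pos_ineq Z W p q S C]].

End Defs.
Arguments conj_exp {R} r%_ereal_scope.
Arguments lnorm {R} r%_ereal_scope n a.

(* Main.v *)
Require Import Defs.
From HB Require Import structures.
From mathcomp Require Import all_boot all_order all_algebra.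
From mathcomp Require Import all_classical all_reals all_analysis.
From mathcomp Require Import ring lra.
Import Order.TTheory GRing.Theory Num.Theory.
Import numFieldNormedType.Exports.
Local Open Scope classical_set_scope.
Local Open Scope ring_scope.

(* Both operators satisfy trilinear inequalities between a family of vectors and
   a family of functionals. Passing from T* to T means testing T* on the image
   of a family of X in its bidual, together with the Riesz--Kantorovich formula
   f(|y|) = max {g(y) : |g| <= f}. Passing from T to T* requires replacing a
   family of bidual elements by vectors. The weak q-norm of a finite family x
   is, up to a factor close to 1, the maximum of |sum_i a_i x_i| over a finite
   grid of points a of the dual ball of l_q^n (with positive parts in the
   lattice case), so Hahn--Banach in a finite power of the space dominates the
   functionals g_i of T* by finite sums of a_i psi with sum |psi| controlled;
   elements of the bidual can then be applied term by term. *)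

(** * Sublinear functionals and Hahn--Banach *)

(** The obstacle is that functionals on a dual space need not be evaluations at vectors, so a bound
    for [T] says nothing directly about families in the bidual. Such a functional is known to
    commute only with finite linear combinations; an integral over the dual ball dominating the
    [g_i] could not be moved through it, whence the finite grid. Its price is the factor
    [1 + n / N]: each of the [n] coordinates is rounded by at most [1 / N]. As [n] is fixed, the
    factor tends to 1 with growing [N], so the constants agree exactly and the two norms are equal.
    Lattices and Banach spaces are treated together through a cone [P] and a sublinear [nu]: the
    positive cone with the norm of the positive part, or the whole space with the norm. *)

Definition sublinear {R : realType} {W : lmodType R} (p : W -> R) : Prop :=
  (forall x y, p (x + y) <= p x + p y) /\
  (forall a x, 0 <= a -> p (a *: x) = a * p x).

(** A predicate on bare functions, since the elements of [dual] are functions with a membership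
    predicate and not bundled linear maps. *)
Definition linear_form {R : realType} {W : lmodType R} (f : W -> R) : Prop :=
  forall a x y, f (a *: x + y) = a * f x + f y.

Definition convex_cone {R : realType} {W : lmodType R} (C : set W) : Prop :=
  [/\ C 0, (forall x y, C x -> C y -> C (x + y)) &
      (forall a x, 0 <= a -> C x -> C (a *: x))].

Definition ray {R : realType} {W : lmodType R} (x : W) : set W :=
  [set t *: x | t in [set t : R | 0 <= t]].

Lemma ray_id {R : realType} {W : lmodType R} (x : W) : ray x x.
Proof. by exists 1; rewrite ?scale1r//=. Qed.

Lemma convex_cone_ray {R : realType} {W : lmodType R} (x : W) :
  convex_cone (ray x).
Proof.
split=> [|_ _ [t t0 <-] [u u0 <-]|a _ a0 [t t0 <-]].
- by exists 0; rewrite ?scale0r//=.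
- by exists (t + u); [exact: addr_ge0 | rewrite scalerDl].
- by exists (a * t); [exact: mulr_ge0 | rewrite scalerA].
Qed.

Section LinearForm.
Context {R : realType} {W : lmodType R} {f : W -> R} (hf : linear_form f).

Lemma linear_form0 : f 0 = 0.
Proof. by have := hf 1 0 0; rewrite scale1r addr0; lra. Qed.

Lemma linear_formD x y : f (x + y) = f x + f y.
Proof. by rewrite -{1}(scale1r x) hf mul1r. Qed.

Lemma linear_formZ a x : f (a *: x) = a * f x.
Proof. by rewrite -{1}(addr0 (a *: x)) hf linear_form0 addr0. Qed.

Lemma linear_formN x : f (- x) = - f x.
Proof. by rewrite -scaleN1r linear_formZ mulN1r. Qed.

Lemma linear_formB x y : f (x - y) = f x - f y.
Proof. by rewrite linear_formD linear_formN. Qed.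

Lemma linear_form_sum (I : finType) (x : I -> W) :
  f (\sum_i x i) = \sum_i f (x i).
Proof.
by apply: (big_morph f); [exact: linear_formD | exact: linear_form0].
Qed.

End LinearForm.

Section Sublinear.
Local Set Implicit Arguments.
Local Unset Strict Implicit.
Context {R : realType} {W : lmodType R}.
Implicit Type p : W -> R.

Lemma sublinear0 p : sublinear p -> p 0 = 0.
Proof. by move=> [_ pZ]; rewrite -(scale0r 0) pZ// mul0r. Qed.

Lemma sublinear_ge_opp p x : sublinear p -> - p (- x) <= p x.
Proof.
by move=> sp; have := sp.1 x (- x); rewrite subrr sublinear0//; lra.
Qed.

(** Applying the scaling inequality with [a^-1] at [a *: x] gives its reverse; functionals built as
    infima or maxima then need only upper bounds. *)
Lemma sublinear_of_le p : p 0 = 0 ->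
  (forall x y, p (x + y) <= p x + p y) ->
  (forall a x, 0 < a -> p (a *: x) <= a * p x) -> sublinear p.
Proof.
move=> p0 pD pZ; split=> // a x; rewrite le_eqVlt => /predU1P[<-|a0].
  by rewrite scale0r p0 mul0r.
apply/eqP; rewrite eq_le pZ//=.
have := pZ a^-1 (a *: x); rewrite invr_gt0 => /(_ a0).
by rewrite scalerA mulVf ?gt_eqF// scale1r ler_pdivlMl.
Qed.

(* The largest sublinear functional below p whose value at -w is at most -t
   for every (w, t) in C. *)
Definition cone_inf p (C : set (W * R^o)%type) (y : W) : R :=
  inf [set p (y + c.1) - c.2 | c in C].

Section ConeInf.
Variables (p : W -> R) (C : set (W * R^o)%type).
Hypotheses (sp : sublinear p) (cC : convex_cone C).
Hypothesis Cp : forall c, C c -> c.2 <= p c.1.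

Let lb y c : C c -> - p (- y) <= p (y + c.1) - c.2.
Proof.
by move=> Cc; have := sp.1 (- y) (y + c.1); rewrite addKr; have := Cp Cc; lra.
Qed.

Let has_lb y : has_lbound [set p (y + c.1) - c.2 | c in C].
Proof. by exists (- p (- y)) => _ [c Cc <-]; exact: lb. Qed.

Lemma cone_inf_lb y c : C c -> cone_inf p C y <= p (y + c.1) - c.2.
Proof. by move=> Cc; apply: ge_inf; [exact: has_lb | exists c]. Qed.

Let glb y z : (forall c, C c -> z <= p (y + c.1) - c.2) -> z <= cone_inf p C y.
Proof.
move=> h; apply: lb_le_inf => [|_ [c Cc <-]]; last exact: h.
by have [C0 _ _] := cC; eexists; exists 0.
Qed.

Lemma cone_inf_le y : cone_inf p C y <= p y.
Proof.
have [C0 _ _] := cC; apply: (le_trans (cone_inf_lb y C0)).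
by rewrite /= addr0 subr0.
Qed.

Lemma cone_inf_opp c : C c -> cone_inf p C (- c.1) <= - c.2.
Proof.
move=> Cc; apply: (le_trans (cone_inf_lb _ Cc)).
by rewrite addNr sublinear0// sub0r.
Qed.

Lemma cone_inf_sublinear : sublinear (cone_inf p C).
Proof.
have [C0 CD CZ] := cC; apply: sublinear_of_le.
- apply/eqP; rewrite eq_le; apply/andP; split.
    by have := cone_inf_opp C0; rewrite /= !oppr0.
  by apply: glb => c Cc; rewrite add0r subr_ge0; exact: Cp.
- move=> x y.
  (* The two infima are taken one after the other; for [c] and [d] in [C], the point [c + d] of [C]
     bounds the left-hand side. *)
  suff h : forall c, C c -> cone_inf p C (x + y) - (p (x + c.1) - c.2)
      <= cone_inf p C y.
    suff : cone_inf p C (x + y) - cone_inf p C y <= cone_inf p C x by lra.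
    by apply: glb => c Cc; have := h _ Cc; lra.
  move=> c Cc; apply: glb => d Cd.
  have := cone_inf_lb (x + y) (CD _ _ Cc Cd).
  have := sp.1 (x + c.1) (y + d.1); rewrite /= addrACA.
  set u := p _; set v := p _; set w := p _; set z := cone_inf _ _ _.
  by lra.
- move=> a x a0; rewrite -ler_pdivrMl//; apply: glb => c Cc.
  rewrite ler_pdivrMl//; apply: (le_trans (cone_inf_lb _ (CZ _ _ (ltW a0) Cc))).
  by rewrite /= -scalerDr (sp.2 _ _ (ltW a0)) mulrBr.
Qed.

End ConeInf.

(* A minimal sublinear functional s agrees with its own [cone_inf] along the
   ray of any x, which forces s (- x) <= - s x. *)
Lemma minimal_sublinear_linear (s : W -> R) : sublinear s ->
  (forall s', sublinear s' -> (forall x, s' x <= s x) -> s' = s) ->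
  linear_form s.
Proof.
move=> ss smin.
have sN x : s (- x) = - s x.
  pose C := ray (x, s x : R^o).
  have cC : convex_cone C := convex_cone_ray _.
  have Cp : forall c, C c -> c.2 <= s c.1.
    by move=> _ [t t0 <-] /=; rewrite ss.2.
  have e := smin _ (cone_inf_sublinear ss cC Cp) (cone_inf_le ss cC Cp).
  have Cx : C (x, s x) by exact: ray_id.
  have := cone_inf_opp ss Cp Cx; rewrite e /=.
  by have := sublinear_ge_opp x ss => h1 h2; apply: le_anti; apply/andP; lra.
have sD x y : s (x + y) = s x + s y.
  apply/le_anti; rewrite ss.1 /=.
  by have := ss.1 (x + y) (- y); rewrite addrK sN; lra.
move=> a x y; rewrite sD; congr (_ + _).
have [a0|a0] := leP 0 a; first exact: ss.2.
by rewrite -[a]opprK scaleNr sN ss.2 ?mulNr// oppr_ge0 ltW.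
Qed.

(** Zorn's lemma for the sublinear functionals below [p], smaller ones counting as larger: the
    infimum of a chain is finite because each member is at least [- p (- x)] at [x], and a minimal
    element is linear. *)
Lemma exists_linear_form_le p : sublinear p ->
  exists2 f, linear_form f & forall x, f x <= p x.
Proof.
move=> sp.
pose T := {s : W -> R | sublinear s /\ forall x, s x <= p x}.
pose ge (s t : T) : bool := `[< forall x, sval t x <= sval s x >].
have geP s t : ge s t <-> forall x, sval t x <= sval s x.
  by split=> [/asboolP//|h]; apply/asboolP.
have [|s t u /geP h1 /geP h2|s t /geP h1 /geP h2|A Atot|s smin] := @Zorn T ge.
- by move=> t; apply/geP.
- by apply/geP => x; exact: le_trans (h1 x).
- have e : sval s = sval t by apply/funext => x; apply/le_anti; rewrite h1 h2.
  by case: s t e {h1 h2} => [s ps] [t pt] /= e; subst t; congr exist.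
(* The empty chain is bounded by [p] itself, as the infimum below needs a member. *)
- have [[s0 As0]|A0] := pselect (A !=set0); last first.
    exists (exist _ p (conj sp (fun=> lexx _))) => s As.
    by exfalso; apply: A0; exists s.
  pose m x := inf [set sval s x | s in A].
  have mlb s x : A s -> m x <= sval s x.
    move=> As; apply: ge_inf; last by exists s.
    exists (- p (- x)) => _ [t At <-]; have [st tp] := svalP t.
    by have := sublinear_ge_opp x st; have := tp (- x); lra.
  have mglb x z : (forall s, A s -> z <= sval s x) -> z <= m x.
    move=> h; apply: lb_le_inf => [|_ [t At <-]]; last exact: h.
    by exists (sval s0 x), s0.
  have sm : sublinear m.
    apply: sublinear_of_le.
    - apply/le_anti/andP; split.
        by apply: (le_trans (mlb s0 0 As0)); rewrite sublinear0//; have [] := svalP s0.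
      by apply: (mglb) => s _; rewrite sublinear0//; have [] := svalP s.
    - move=> x y.
      suff h : forall s t, A s -> A t -> m (x + y) <= sval s x + sval t y.
        suff : m (x + y) - m y <= m x by lra.
        apply: (mglb) => s As; rewrite lerBlDr -lerBlDl; apply: (mglb) => t At.
        by rewrite lerBlDl; exact: h.
      move=> s t As At; have [ss _] := svalP s; have [st _] := svalP t.
      (* Of two members of the chain, the smaller one serves for both terms. *)
      case: (Atot _ _ As At) => /geP h.
        apply: (le_trans (mlb _ _ At)); apply: (le_trans (st.1 _ _)).
        by rewrite lerD2r.
      apply: (le_trans (mlb _ _ As)); apply: (le_trans (ss.1 _ _)).
      by rewrite lerD2l.
    - move=> a x a0; rewrite -ler_pdivrMl//; apply: (mglb) => s As.
      have [ss _] := svalP s.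
      by rewrite ler_pdivrMl// -(ss.2 _ _ (ltW a0)); exact: mlb.
  have mp x : m x <= p x.
    by apply: (le_trans (mlb s0 x As0)); have [] := svalP s0.
  by exists (exist _ m (conj sm mp)) => s As; apply/geP => x /=; exact: mlb.
- have [ss sp'] := svalP s.
  exists (sval s); last exact: sp'.
  apply: minimal_sublinear_linear => // s' ss' s's.
  have s'p x : s' x <= p x by exact: le_trans (s's x) (sp' x).
  pose t : T := exist _ s' (conj ss' s'p).
  by have <- : t = s by apply: smin; apply/geP.
Qed.

(** A linear form [f] below [cone_inf p C] satisfies [f (- c.1) <= - c.2], which linearity turns
    into [c.2 <= f c.1]; domination alone thus yields the lower bound on the cone as well. *)
Theorem hahn_banach_cone p (C : set (W * R^o)%type) :
  sublinear p -> convex_cone C -> (forall c, C c -> c.2 <= p c.1) ->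
  exists f, [/\ linear_form f, (forall x, f x <= p x) &
                forall c, C c -> c.2 <= f c.1].
Proof.
move=> sp cC Cp.
have [f lf fle] := exists_linear_form_le (cone_inf_sublinear sp cC Cp).
exists f; split=> // [x|c Cc].
  exact: le_trans (fle x) (cone_inf_le sp cC Cp x).
rewrite -lerN2 -(linear_formN lf).
exact: le_trans (fle _) (cone_inf_opp sp Cp Cc).
Qed.

Lemma hahn_banach_at p x : sublinear p ->
  exists f, [/\ linear_form f, (forall y, f y <= p y) & f x = p x].
Proof.
move=> sp.
have [_ [t t0 <-]|f [lf fp fC]] := hahn_banach_cone sp (convex_cone_ray (x, p x : R^o)).
  by rewrite /= sp.2.
exists f; split=> //; apply/le_anti; rewrite fp /=.
exact: (fC _ (ray_id _)).
Qed.

End Sublinear.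

(** * The norm of l_r^n and its dual ball *)

(** Young's inequality with exponents [r / (r - 1)] and [r], written without the conjugate exponent
    so that [r = 1] is included. *)
Lemma young_powR {R : realType} (r u v : R) : 1 <= r -> 0 <= u -> 0 <= v ->
  u `^ (r - 1) * v <= (1 - r^-1) * u `^ r + r^-1 * v `^ r.
Proof.
move=> r1 u0 v0; have r0 : 0 < r by lra.
have [->|rn1] := eqVneq r 1.
  by rewrite subrr powRr0 !powRr1// invr1 subrr !mul1r mul0r add0r.
have r11 : 0 < r - 1 by rewrite subr_gt0 lt_neqAle eq_sym rn1.
have := @conjugate_powR R (u `^ (r - 1)) v (r / (r - 1)) r.
rewrite powR_ge0 v0 divr_gt0// r0 invf_div -powRrM => /(_ isT isT isT isT).
have -> : (r - 1) * (r / (r - 1)) = r by field; rewrite subr_eq0.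
have e : (r - 1) / r = 1 - r^-1 by field; rewrite gt_eqF.
rewrite e subrK => /(_ erefl).
by rewrite [_ * (1 - _)]mulrC [_ / r]mulrC.
Qed.

Lemma sg_mul_powR {R : realType} (x d : R) : 0 < x ->
  Num.sg d * `|d| `^ (x - 1) * d = `|d| `^ x.
Proof.
move=> x0; rewrite mulrAC -normrEsg.
have [->|d0] := eqVneq d 0; first by rewrite normr0 mul0r powR0// gt_eqF.
rewrite -[X in X * _]powRr1// -powRD; first by congr (_ `^ _); lra.
by rewrite normr_eq0 d0 implybT.
Qed.

Section Lnorm.
Local Set Implicit Arguments.
Local Unset Strict Implicit.
Context {R : realType}.
Implicit Types (r : \bar R) (n : nat).

Lemma lnorm_ge0 r n (a : 'I_n -> R) : 0 <= lnorm r n a.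
Proof.
case: r => [x| |] //=; first exact: powR_ge0.
by elim/big_ind: _ => // x y x0 y0; rewrite le_max x0.
Qed.

Lemma ler_lnorm r n (a b : 'I_n -> R) : (1 <= r)%E ->
  (forall i, `|a i| <= `|b i|) -> lnorm r n a <= lnorm r n b.
Proof.
case: r => [x| |]; last by [].
- rewrite lee_fin => x1 ab /=.
  apply: ge0_ler_powR; rewrite ?nnegrE ?invr_ge0 ?sumr_ge0//; first by lra.
  apply: ler_sum => i _; apply: ge0_ler_powR; rewrite ?nnegrE//; lra.
- by move=> _ ab /=; apply: le_bigmax2 => i _; exact: ab.
Qed.

Lemma lnormZ r n (c : R) (a : 'I_n -> R) : (1 <= r)%E ->
  lnorm r n (fun i => c * a i) = `|c| * lnorm r n a.
Proof.
case: r => [x| |] /=; last by [].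
- rewrite lee_fin => x1.
  have -> : \sum_(i < n) `|c * a i| `^ x = `|c| `^ x * \sum_(i < n) `|a i| `^ x.
    by rewrite mulr_sumr; apply: eq_bigr => i _; rewrite normrM powRM.
  rewrite powRM ?sumr_ge0 ?powR_ge0// -powRrM divff ?powRr1//.
  by rewrite gt_eqF//; lra.
- move=> _; elim/big_ind2: _ => [|x1 x2 y1 y2 -> ->|i _].
  + by rewrite mulr0.
  + by rewrite maxr_pMr.
  + exact: normrM.
Qed.

Lemma lnorm_delta r n (i : 'I_n) (c : R) : (1 <= r)%E ->
  lnorm r n (fun j => if j == i then c else 0) = `|c|.
Proof.
case: r => [x| |] /=; last by [].
- rewrite lee_fin => x1.
  have x0 : x != 0 by rewrite gt_eqF//; lra.
  rewrite (bigD1 i)//= eqxx big1 ?addr0 -?powRrM ?divff ?powRr1//.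
  by move=> j /negbTE ->; rewrite normr0 powR0.
- move=> _; apply/le_anti/andP; split; last first.
    by have := le_bigmax 0 (fun j : 'I_n => `|if j == i then c else 0|) i; rewrite eqxx.
  by apply: bigmax_le => // j _; case: eqP => // _; rewrite normr0.
Qed.

Lemma ler_norm_lnorm r n (a : 'I_n -> R) i : (1 <= r)%E ->
  `|a i| <= lnorm r n a.
Proof.
move=> r1; rewrite -(lnorm_delta i (a i) r1); apply: ler_lnorm => // j.
by case: eqP => [->|_]; rewrite ?normr0.
Qed.

Lemma lnorm_eq0 r n (a : 'I_n -> R) i : (1 <= r)%E -> lnorm r n a = 0 -> a i = 0.
Proof.
move=> r1 a0; apply/normr0_eq0/le_anti; rewrite normr_ge0 andbT -a0.
exact: ler_norm_lnorm.
Qed.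

Lemma lnorm_powR (x : R) n (a : 'I_n -> R) : 1 <= x ->
  lnorm x%:E n a `^ x = \sum_(i < n) `|a i| `^ x.
Proof.
by move=> x1; rewrite /= -powRrM mulVf ?powRr1 ?sumr_ge0// gt_eqF//; lra.
Qed.

(* The unit ball for the norm dual to [lnorm r]. *)
Definition polar r n (a : 'I_n -> R) : Prop :=
  forall b, \sum_(i < n) a i * b i <= lnorm r n b.

(** Testing [a] on the vector of the |b_i| with the signs of [a] bounds the sum for [a'], and this
    vector has norm at most that of [b]. This solidity is what permits rounding towards zero. *)
Lemma polar_dominated r n (a a' : 'I_n -> R) :
  (1 <= r)%E ->
  (forall i, `|a' i| <= `|a i|) -> polar r a -> polar r a'.
Proof.
move=> r1 aa' pa b.
apply: (@le_trans _ _ (\sum_(i < n) a i * (Num.sg (a i) * `|b i|))).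
  apply: ler_sum => i _; rewrite mulrA [a i * _]mulrC -normrEsg.
  by apply: (le_trans (ler_norm _)); rewrite normrM ler_wpM2r.
apply: (le_trans (pa _)).
apply: ler_lnorm => // i; rewrite normrM normr_id normr_sg.
by case: (a i != 0); rewrite ?mul1r ?mul0r.
Qed.

Lemma polar_delta r n (i : 'I_n) (c : R) : (1 <= r)%E -> `|c| <= 1 ->
  polar r (fun j : 'I_n => if j == i then c else 0).
Proof.
move=> r1 c1 b; rewrite (bigD1 i)//= eqxx big1 => [|j /negbTE ->]; last by rewrite mul0r.
rewrite addr0; apply: (le_trans (ler_norm _)); rewrite normrM.
apply: (@le_trans _ _ `|b i|); first by rewrite ler_piMl.
exact: ler_norm_lnorm.
Qed.

Lemma polar_le1 r n (a : 'I_n -> R) i : (1 <= r)%E -> polar r a -> `|a i| <= 1.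
Proof.
move=> r1 pa; have := pa (fun j => if j == i then Num.sg (a i) else 0).
rewrite lnorm_delta// (bigD1 i)//= eqxx big1 => [|j /negbTE ->]; last by rewrite mulr0.
by rewrite addr0 mulrC -normrEsg => /le_trans; apply; rewrite normr_sg; case: (a i != 0).
Qed.

Lemma polar0 r n : polar r (fun _ : 'I_n => 0).
Proof. by move=> b; rewrite big1 ?lnorm_ge0// => i _; rewrite mul0r. Qed.

(** The extremal functional of Hölder's inequality at a unit vector: with [c] normalized, the terms
    of Young's inequality sum to [(1 - x^-1) + x^-1 = 1]. *)
Lemma polar_powR (x : R) n (b : 'I_n -> R) : 1 <= x -> lnorm x%:E n b = 1 ->
  polar x%:E (fun i => Num.sg (b i) * `|b i| `^ (x - 1)).
Proof.
move=> x1 b1 c.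
have [c0|c0] := eqVneq (lnorm x%:E n c) 0.
  by rewrite c0 big1// => i _; rewrite (@lnorm_eq0 x%:E n c i) ?mulr0.
have cgt0 : 0 < lnorm x%:E n c by rewrite lt_neqAle eq_sym c0 lnorm_ge0.
rewrite -[leRHS]mulr1 -(ler_pdivrMl _ _ cgt0) mulr_sumr.
set M := lnorm _ _ _ in c0 cgt0 *.
have d1 : lnorm x%:E n (fun i => M^-1 * c i) = 1.
  by rewrite lnormZ// gtr0_norm ?invr_gt0// mulVf.
apply: (@le_trans _ _ (\sum_(i < n) ((1 - x^-1) * `|b i| `^ x +
    x^-1 * `|M^-1 * c i| `^ x))).
  apply: ler_sum => i _; rewrite mulrCA.
  apply: le_trans (young_powR _ _ _ x1 (normr_ge0 _) (normr_ge0 _)).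
  apply: (le_trans (ler_norm _)); rewrite normrM normrM ler_wpM2r//.
  rewrite normr_sg [`|_ `^ _|]ger0_norm ?powR_ge0//.
  by case: (b i != 0); rewrite ?mul1r ?mul0r ?powR_ge0.
rewrite big_split -!mulr_sumr /= -!lnorm_powR// b1 d1 powR1.
by rewrite !mulr1 subrK.
Qed.

(** The norm is attained: for finite [r] at the Hölder extremal of the normalized vector, for
    [r = +oo] at a signed unit vector in a coordinate of largest modulus. The sign clause later
    keeps combinations of positive functionals positive. *)
Lemma exists_polar_eq r n (b : 'I_n -> R) : (1 <= r)%E ->
  exists a, [/\ polar r a, \sum_(i < n) a i * b i = lnorm r n b &
                forall i, 0 <= b i -> 0 <= a i].
Proof.
move=> r1; have [b0|bn0] := eqVneq (lnorm r n b) 0.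
  exists (fun=> 0); split=> //; first exact: polar0.
  by rewrite b0 big1// => i _; rewrite mul0r.
have b0 : 0 < lnorm r n b by rewrite lt_neqAle eq_sym bn0 lnorm_ge0.
case: r r1 bn0 b0 => [x| |] //.
- rewrite lee_fin => x1 bn0 b0; set L := lnorm _ _ _ in bn0 b0 *.
  have d1 : lnorm x%:E n (fun i => L^-1 * b i) = 1.
    by rewrite lnormZ// gtr0_norm ?invr_gt0// mulVf.
  exists (fun i => Num.sg (L^-1 * b i) * `|L^-1 * b i| `^ (x - 1)); split.
  + exact: polar_powR.
  + transitivity (L * \sum_(i < n) `|L^-1 * b i| `^ x).
      rewrite mulr_sumr; apply: eq_bigr => i _.
      by rewrite -[in RHS]sg_mul_powR ?mulVKf ?(lt_le_trans ltr01)// mulrCA mulVKf.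
    by rewrite -lnorm_powR// d1 powR1 mulr1.
  + move=> i bi; rewrite mulr_ge0 ?powR_ge0// sgr_ge0 mulr_ge0//.
    by rewrite invr_ge0 ltW.
- move=> _ bn0 _.
  have [b0|/existsNP[k bk]] := pselect (forall i, b i = 0).
    case/eqP: bn0; apply/le_anti; rewrite lnorm_ge0 andbT /=.
    by apply: bigmax_le => [//|i _]; rewrite b0 normr0.
  have [i _ bi] := @arg_maxP _ _ _ k predT (fun i => `|b i|) isT.
  exists (fun j => if j == i then Num.sg (b i) else 0); split.
  + by apply: polar_delta; rewrite ?leey // normr_sg; case: (b i != 0).
  + rewrite (bigD1 i)//= eqxx big1 => [|j /negbTE ->]; last by rewrite mul0r.
    rewrite addr0 -normrEsg; apply/le_anti/andP; split.
      exact: (le_bigmax 0 (fun j : 'I_n => `|b j|) i).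
    by apply: bigmax_le => // j _; exact: bi.
  + by move=> j bj; case: eqP => // <-; rewrite sgr_ge0.
Qed.

Lemma conj_exp_ge1 r : (1 <= r)%E -> (1 <= conj_exp r)%E.
Proof.
case: r => [x| |] //=; rewrite lee_fin => x1; case: eqVneq => [_|xn1]; first exact: leey.
have x0 : 0 < x - 1 by rewrite subr_gt0 lt_neqAle eq_sym xn1 x1.
by rewrite lee_fin ler_pdivlMr//; lra.
Qed.

Lemma conj_expK (x : R) : 1 <= x -> conj_exp (conj_exp x%:E) = x%:E.
Proof.
move=> x1 /=; case: eqVneq => [->//|xn1] /=.
have x0 : x - 1 != 0 by rewrite subr_eq0.
case: eqVneq => [|_].
  move=> e; have : x / (x - 1) * (x - 1) = x - 1 by rewrite e mul1r.
  by rewrite divfK// => ?; exfalso; lra.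
congr EFin; field; rewrite x0 /=.
have -> : x + -1 * (x - 1) = 1 by ring.
exact: oner_neq0.
Qed.

(** For the adjoint the outer exponent is conjugate to a finite one, so there [pi_norm] is always
    the supremum and never the convention at exponent 1. *)
Lemma conj_exp_neq1 (x : R) : 1 <= x -> conj_exp x%:E != 1%E.
Proof.
move=> x1; apply/eqP => e; have := conj_expK x1.
by rewrite e /= eqxx.
Qed.

End Lnorm.

(** * Finite decompositions on a cone *)

(** The [y k] range independently: freezing the other coordinates bounds each [A k], and
    simultaneous near-optimal choices bound the sum of the suprema. *)
Lemma sum_sup_le {R : realType} {K : finType} (A : K -> set R) (S : R) :
  (forall k, A k !=set0) ->
  (forall y, (forall k, A k (y k)) -> \sum_k y k <= S) ->
  (forall k, has_sup (A k)) /\ \sum_k sup (A k) <= S.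
Proof.
move=> A0 AS; have hs k : has_sup (A k).
  split; first exact: A0.
  have [y0 Ay0] := choice A0; exists (S - \sum_(j | j != k) y0 j) => t At.
  rewrite lerBrDr.
  have := AS (fun j => if j == k then t else y0 j).
  rewrite (bigD1 k)//= eqxx (eq_bigr y0) => [|j /negbTE -> //].
  by apply=> j; case: eqP => [->|].
split=> //; apply/ler_addgt0Pr => e e0.
(* The successor keeps the denominator nonzero when [K] is empty. *)
have d0 : 0 < e / #|K|.+1%:R by rewrite divr_gt0.
have /choice[y Ay] : forall k, exists t, A k t /\ sup (A k) - e / #|K|.+1%:R < t.
  by move=> k; have [t At lt] := sup_adherent d0 (hs k); exists t.
have h : \sum_k sup (A k) <= \sum_k (y k + e / #|K|.+1%:R).
  by apply: ler_sum => k _; rewrite -lerBlDr ltW//; have [] := Ay k.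
apply: (le_trans h); rewrite big_split /= sumr_const.
apply: lerD; first by apply: AS => k; have [] := Ay k.
by rewrite -[leLHS]mulr_natr mulrAC ler_pdivrMr// ler_pM2l// ler_nat.
Qed.

(** * A rational grid in the dual ball of [lnorm r] *)

Section Grid.
Local Set Implicit Arguments.
Local Unset Strict Implicit.
Context {R : realType} {n : nat}.
Variables (r : \bar R) (N : nat).
Hypotheses (r1 : (1 <= r)%E) (N0 : (0 < N)%N).

(** The index, a numerator at most [N] and a sign bit per coordinate, ranges over a finite type;
    zero is coded with both signs, which does no harm. *)
Definition grid_point (k : {ffun 'I_n -> 'I_N.+1 * bool}) (i : 'I_n) : R :=
  (-1) ^+ (k i).2 * ((k i).1%:R / N%:R).

Let N0R : 0 < N%:R :> R. Proof. by rewrite ltr0n. Qed.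

Lemma norm_grid_point k i : `|grid_point k i| = (k i).1%:R / N%:R.
Proof. by rewrite normrM normrX normrN1 expr1n mul1r ger0_norm ?divr_ge0. Qed.

(** Truncating [N] times |a_i| rounds every coordinate towards zero, so the result stays in the dual
    ball by solidity. *)
Lemma grid_point_near (a : 'I_n -> R) : polar r a -> exists k,
  polar r (grid_point k) /\ forall i, `|a i - grid_point k i| <= N%:R^-1.
Proof.
move=> pa.
pose t i := Num.truncn (N%:R * `|a i|).
have ht i : (t i)%:R <= N%:R * `|a i| < (t i).+1%:R.
  by apply: Num.Theory.truncn_itv; rewrite mulr_ge0.
have tN i : (t i < N.+1)%N.
  have /andP[h _] := ht i; rewrite ltnS -(ler_nat R); apply: (le_trans h).
  by rewrite ler_piMr// (polar_le1 i r1 pa).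
pose k : {ffun 'I_n -> 'I_N.+1 * bool} := [ffun i => (Ordinal (tN i), a i < 0)].
exists k; split.
  apply: polar_dominated pa => // i; rewrite norm_grid_point ffunE /=.
  by rewrite ler_pdivrMr// mulrC; have /andP[] := ht i.
move=> i; rewrite {1}[a i]numEsign /grid_point ffunE /= -mulrBr.
rewrite normrM normrX normrN1 expr1n mul1r.
have /andP[h1 h2] := ht i.
have -> : `|a i| - (t i)%:R / N%:R = (N%:R * `|a i| - (t i)%:R) / N%:R.
  by rewrite mulrBl mulrAC divff ?mul1r// gt_eqF.
rewrite normrM [`|_^-1|]gtr0_norm ?invr_gt0// ler_piMl ?invr_ge0 ?ltW//.
by move: h2; rewrite ger0_norm ?subr_ge0// -natr1; lra.
Qed.

(** Since signed unit vectors lie exactly on the grid, a bound over grid points also bounds every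
    single coordinate. *)
Lemma grid_point_delta (i : 'I_n) (s : bool) : exists k, forall j,
  grid_point k j = if j == i then (-1) ^+ s else 0.
Proof.
exists [ffun j => if j == i then (ord_max, s) else (ord0, false)] => j.
rewrite /grid_point ffunE; case: eqP => _ /=.
  by rewrite divff ?mulr1// gt_eqF.
by rewrite mul0r mulr0.
Qed.

End Grid.

Section ConeDecomposition.
Local Set Implicit Arguments.
Local Unset Strict Implicit.
Context {R : realType} {V : lmodType R}.
Variables (P : set V) (nu : V -> R) (n : nat) (r : \bar R).
Variables (g : 'I_n -> V -> R) (S : R).
Hypotheses (cP : convex_cone P) (snu : sublinear nu) (nu0 : forall v, 0 <= nu v).
Hypotheses (r1 : (1 <= r)%E) (S0 : 0 <= S).
Hypothesis gD : forall i x y, P x -> P y -> g i (x + y) = g i x + g i y.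
Hypothesis gZ : forall i a x, 0 <= a -> P x -> g i (a *: x) = a * g i x.

Let grid N := {k : {ffun 'I_n -> 'I_N.+1 * bool} | `[< polar r (@grid_point R n N k) >]}.

Let gridp N (k : grid N) : 'I_n -> R := grid_point (val k).

(** A norming point for the [h (x i)] is rounded to the grid: the grid point contributes at most
    [m], and each of the [n] rounding errors at most [m / N], because signed unit vectors bound
    |h(x_i)| by [m]. *)
Lemma lnorm_le_grid N (x : 'I_n -> V) h m : (0 < N)%N ->
  linear_form h -> (forall v, h v <= nu v) ->
  (forall k : grid N, nu (\sum_i gridp k i *: x i) <= m) ->
  lnorm r n (fun i => h (x i)) <= (1 + n%:R / N%:R) * m.
Proof.
move=> N0 lh hnu hm.
have hk k : polar r (@grid_point R n N k) -> \sum_i grid_point k i * h (x i) <= m.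
  move=> pk; have pk' : `[< polar r (@grid_point R n N k) >] by apply/asboolP.
  apply: le_trans (hm (exist _ k pk')); apply: le_trans (hnu _).
  rewrite (linear_form_sum lh); apply: ler_sum => i _.
  by rewrite (linear_formZ lh).
have hi i : `|h (x i)| <= m.
  have [k kE] := @grid_point_delta R n N N0 i (h (x i) < 0).
  have pk : polar r (@grid_point R n N k).
    have -> : grid_point k = fun j => if j == i then (-1) ^+ (h (x i) < 0)%R else 0 :> R.
      exact: funext.
    by apply: polar_delta => //; rewrite normrX normrN1 expr1n.
  have := hk k pk; rewrite (bigD1 i)//= kE eqxx big1 => [|j /negbTE ji]; last first.
    by rewrite kE ji mul0r.
  by rewrite addr0 -normrEsign.
have [a [pa <- _]] := exists_polar_eq (fun i => h (x i)) r1.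
have [k [pk ak]] := grid_point_near r1 N0 pa.
apply: (@le_trans _ _ (\sum_i (grid_point k i * h (x i) + N%:R^-1 * m))).
  apply: ler_sum => i _; rewrite -lerBlDl -mulrBl.
  apply: (le_trans (ler_norm _)); rewrite normrM.
  by apply: ler_pM => //; exact: ak.
rewrite big_split /= sumr_const card_ord mulrDl mul1r.
apply: lerD; first exact: hk.
by rewrite -[leLHS]mulr_natl mulrA.
Qed.

(* Hahn--Banach in the space of families indexed by a finite grid of the dual
   ball of [lnorm r], where the weak norm is, up to a factor close to 1, a
   maximum of finitely many values of nu. *)
Lemma cone_decomposition_grid N : (0 < N)%N ->
  (forall x M, (forall i, P (x i)) ->
    (forall h, linear_form h -> (forall v, h v <= nu v) ->
      lnorm r n (fun i => h (x i)) <= M) ->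
    \sum_i g i (x i) <= S * M) ->
  exists psi : grid N -> V -> R,
    [/\ forall k, linear_form (psi k),
        forall y m, 0 <= m -> (forall k, nu (y k) <= m) ->
          \sum_k psi k (y k) <= S * (1 + n%:R / N%:R) * m &
        forall i v, P v -> g i v <= \sum_k gridp k i * psi k v].
Proof.
move=> N0 hg.
pose S' := S * (1 + n%:R / N%:R).
have S'0 : 0 <= S' by rewrite mulr_ge0// addr_ge0// divr_ge0.
pose W := {ffun grid N -> V}.
pose mx (y : W) := \big[Num.max/0]_k nu (y k).
have mx_ge (y : W) k : nu (y k) <= mx y by exact: (le_bigmax 0 (fun k => nu (y k)) k).
have mx_le (y : W) m : 0 <= m -> (forall k, nu (y k) <= m) -> mx y <= m.
  by move=> m0 hm; apply: bigmax_le => // k _; exact: hm.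
have mx0 (y : W) : 0 <= mx y by rewrite /mx; elim/big_ind: _ => // a b a0 b0; rewrite le_max a0.
have smx : sublinear (fun y : W => S' * mx y).
  apply: sublinear_of_le => [|x y|a x a0].
  - suff -> : mx 0 = 0 by rewrite mulr0.
    apply/le_anti; rewrite mx0 andbT; apply: mx_le => // k.
    by rewrite ffunE (sublinear0 snu).
  - rewrite -mulrDr ler_wpM2l//; apply: mx_le => [|k]; first exact: addr_ge0.
    by rewrite ffunE; apply: (le_trans (snu.1 _ _)); exact: lerD.
  - rewrite mulrCA ler_wpM2l//; apply: mx_le => [|k]; first by rewrite mulr_ge0// ltW.
    by rewrite ffunE (snu.2 _ _ (ltW a0)) ler_pM2l.
have [P0 PD PZ] := cP.
pose comb (x : 'I_n -> V) : W := [ffun k => \sum_i gridp k i *: x i].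
(* Each pair holds the grid combinations of a family [x] in [P] and the lower bound demanded of [F]
   there; [hg] and [lnorm_le_grid] place this bound below [S' * mx]. *)
pose C := [set (comb x, \sum_i g i (x i) : R^o) | x in [set x | forall i, P (x i)]].
have g0 i : g i 0 = 0 by rewrite -(scale0r 0) gZ// mul0r.
have [||F [lF Fmx FC]] := @hahn_banach_cone R W _ C smx.
- split=> [|_ _ [x Px <-] [y Py <-]|a _ a0 [x Px <-]].
  + exists (fun=> 0) => //; congr pair; last by rewrite big1.
    by apply/ffunP => k; rewrite !ffunE big1// => i _; rewrite scaler0.
  + exists (fun i => x i + y i) => [i /=|]; first exact: PD.
    congr pair; last by rewrite -big_split; apply: eq_bigr => i _; rewrite gD.
    by apply/ffunP => k; rewrite !ffunE -big_split; apply: eq_bigr => i _; rewrite scalerDr.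
  + exists (fun i => a *: x i) => [i /=|]; first exact: PZ.
    congr pair; last first.
      by rewrite /GRing.scale /= mulr_sumr; apply: eq_bigr => i _; rewrite gZ.
    apply/ffunP => k; rewrite !ffunE scaler_sumr; apply: eq_bigr => i _.
    by rewrite !scalerA mulrC.
- move=> _ [x Px <-] /=; rewrite /S' -mulrA; apply: hg => // h lh hnu.
  by apply: lnorm_le_grid => // k; have := mx_ge (comb x) k; rewrite ffunE.
(* Splitting [F] along the coordinates of [W] produces the [psi k]. *)
pose single (k : grid N) (v : V) : W := [ffun j => if j == k then v else 0].
have FE (y : W) : F y = \sum_k F (single k (y k)).
  rewrite -(linear_form_sum lF); congr F; apply/ffunP => j.
  rewrite sum_ffunE (bigD1 j)//= ffunE eqxx big1 ?addr0// => k /negbTE kj.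
  by rewrite ffunE eq_sym kj.
exists (fun k v => F (single k v)); split.
- move=> k a x y; rewrite -lF; congr F; apply/ffunP => j; rewrite !ffunE.
  by case: eqP => // _; rewrite scaler0 addr0.
- move=> y m m0 hm.
  have := Fmx (finfun y); rewrite FE.
  under eq_bigr => k _ do rewrite ffunE.
  move=> /le_trans; apply; rewrite ler_wpM2l//; apply: mx_le => // k.
  by rewrite ffunE.
- move=> i v Pv.
  (* The family concentrated at [i] isolates [g i]. *)
  pose x j : V := if j == i then v else 0.
  have Px j : P (x j) by rewrite /x; case: eqP.
  have := FC _ (ex_intro2 _ _ x Px erefl).
  rewrite /= FE (bigD1 i)//= {1}/x eqxx big1 => [|j /negbTE ji]; last first.
    by rewrite /x ji.
  rewrite addr0 => /le_trans; apply; apply: ler_sum => k _.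
  rewrite ffunE (bigD1 i)//= {1}/x eqxx big1 => [|j /negbTE ji]; last first.
    by rewrite /x ji scaler0.
  rewrite addr0 -(linear_formZ lF) le_eqVlt; apply/orP; left; apply/eqP.
  congr F; apply/ffunP => j; rewrite !ffunE.
  by case: eqP => // _; rewrite scaler0.
Qed.

End ConeDecomposition.

(** * Normed spaces, duals and summing norms *)

(** Lets a bound [V] that may be zero be replaced by positive ones, by which families can be
    divided. *)
Lemma ler_mul_of_gt0 {R : realType} (t K V : R) : 0 <= K -> 0 <= V ->
  (forall V', 0 < V' -> V <= V' -> t <= K * V') -> t <= K * V.
Proof.
move=> K0 V0 h; apply/ler_addgt0Pr => e e0.
have K1 : 0 < K + 1 by rewrite ltr_wpDl.
have d0 : 0 < e / (K + 1) by rewrite divr_gt0.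
apply: (le_trans (h (V + e / (K + 1)) _ _)).
- by rewrite ltr_wpDl.
- by rewrite lerDl ltW.
- rewrite mulrDr lerD2l mulrCA ler_piMr ?(ltW e0)// ler_pdivrMr// mul1r.
  by rewrite lerDl.
Qed.

Lemma ereal_sup_EFin_leP {R : realType} {T : Type} (D : set T) (F : T -> R) (K : R) :
  (ereal_sup [set (F t)%:E | t in D] <= K%:E)%E <-> forall t, D t -> F t <= K.
Proof.
split=> [h t Dt|h].
  by rewrite -lee_fin; apply: le_trans h; apply: ereal_sup_ubound; exists t.
by apply: ge_ereal_sup => _ [t Dt <-]; rewrite lee_fin; exact: h.
Qed.

(** The supremum is finite, as [D] is nonempty and [F] bounded on it, hence is itself the least
    admissible [M]; extended real products then give way to real inequalities. *)
Lemma le_mule_ereal_supP {R : realType} {T : Type} (D : set T) (F : T -> R)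
    (C : R) (X : \bar R) :
  D !=set0 -> (exists B, forall t, D t -> F t <= B) -> 0 <= C ->
  (X <= C%:E * ereal_sup [set (F t)%:E | t in D])%E <->
  forall M, (forall t, D t -> F t <= M) -> (X <= (C * M)%:E)%E.
Proof.
move=> [t0 Dt0] [B FB] C0; split=> [h M FM|h].
  apply: (le_trans h); rewrite EFinM; apply: lee_wpmul2l; first by rewrite lee_fin.
  exact/ereal_sup_EFin_leP.
have hB : (ereal_sup [set (F t)%:E | t in D] <= B%:E)%E by exact/ereal_sup_EFin_leP.
have ht0 : ((F t0)%:E <= ereal_sup [set (F t)%:E | t in D])%E.
  by apply: ereal_sup_ubound; exists t0.
case E : (ereal_sup _) hB ht0 => [s| |] // _ _.
rewrite -EFinM; apply: h => t Dt.
by apply: (iffLR (ereal_sup_EFin_leP D F s)) => //; rewrite E.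
Qed.

Section Nspace.
Local Set Implicit Arguments.
Local Unset Strict Implicit.
Context {R : realType}.
Implicit Type S : nspace R.

(** Laws that [dual] preserves, by [dual_ns_axioms], so that they hold on all iterated duals. The
    norm may vanish on nonzero members: an element of a bidual is a function on all maps, and its
    norm sees only the values on members. *)
Record ns_axioms S : Prop := NsAxioms {
  ns_mem0 : ns_mem S (ns_zero S);
  ns_memD : forall x y, ns_mem S x -> ns_mem S y -> ns_mem S (ns_add S x y);
  ns_memZ : forall a x, ns_mem S x -> ns_mem S (ns_scale S a x);
  ns_addr0 : forall x, ns_add S x (ns_zero S) = x;
  ns_scaler0 : forall a, ns_scale S a (ns_zero S) = ns_zero S;
  ns_scale1r : forall x, ns_scale S 1 x = x;
  ns_norm_ge0 : forall x, ns_mem S x -> 0 <= ns_norm S x;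
  ns_normZ : forall a x, ns_mem S x ->
    ns_norm S (ns_scale S a x) = `|a| * ns_norm S x }.

Section Dual.
Variables (S : nspace R) (hS : ns_axioms S).

Lemma dual_form0 f : ns_mem (dual S) f -> f (ns_zero S) = 0.
Proof.
move=> [lf _]; have := lf 1 _ _ (ns_mem0 hS) (ns_mem0 hS).
by rewrite ns_scaler0// ns_addr0// mul1r; lra.
Qed.

Lemma dual_formZ f a x : ns_mem (dual S) f -> ns_mem S x ->
  f (ns_scale S a x) = a * f x.
Proof.
move=> mf mx; have := mf.1 a _ _ mx (ns_mem0 hS).
by rewrite ns_addr0// dual_form0// addr0.
Qed.

Lemma dual_formD f x y : ns_mem (dual S) f -> ns_mem S x -> ns_mem S y ->
  f (ns_add S x y) = f x + f y.
Proof. by move=> mf mx my; rewrite -{1}(ns_scale1r hS x) mf.1// mul1r. Qed.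

Lemma dual_norm_set0 (f : ns_car S -> R) :
  [set `|f x| | x in [set x | ns_mem S x /\ ns_norm S x <= 1]] !=set0.
Proof.
exists `|f (ns_zero S)|, (ns_zero S) => //; split; first exact: ns_mem0.
have := ns_normZ hS 0 (ns_mem0 hS); rewrite ns_scaler0// normr0 mul0r => ->.
exact: ler01.
Qed.

Lemma dual_norm_ge0 (f : ns_car S -> R) : 0 <= dual_norm S f.
Proof.
rewrite /dual_norm; set A := [set _ | _ in _].
(* For an unbounded function [sup] has the default value 0. *)
have [hA|hA] := pselect (has_sup A); last by rewrite sup_out.
have [t At] := hA.1; apply: (@le_trans _ _ t).
  by have [x _ <-] := At.
by apply: ub_le_sup At; exact: hA.2.
Qed.

Lemma dual_norm_le (f : ns_car S -> R) c : 0 <= c ->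
  (forall x, ns_mem S x -> `|f x| <= c * ns_norm S x) -> dual_norm S f <= c.
Proof.
move=> c0 h; apply: ge_sup; first exact: dual_norm_set0.
move=> _ [x [mx nx] <-]; apply: (le_trans (h _ mx)).
by rewrite ler_piMr.
Qed.

Lemma dual_norm_bound f x : ns_mem (dual S) f -> ns_mem S x ->
  `|f x| <= dual_norm S f * ns_norm S x.
Proof.
move=> mf mx.
have [c hc] : exists c, forall y, ns_mem S y -> `|f y| <= c * ns_norm S y := mf.2.
have ub : has_ubound [set `|f x| | x in [set x | ns_mem S x /\ ns_norm S x <= 1]].
  exists `|c| => _ [y [my ny] <-]; apply: (le_trans (hc _ my)).
  apply: (@le_trans _ _ (`|c| * ns_norm S y)).
    by rewrite ler_wpM2r ?ns_norm_ge0// ler_norm.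
  by rewrite ler_piMr.
(* A vector of norm 0 cannot be normalized; there the boundedness constant already gives
   [f x = 0]. *)
have [n0|n0] := eqVneq (ns_norm S x) 0.
  by have := hc _ mx; rewrite n0 !mulr0.
have npos : 0 < ns_norm S x by rewrite lt_neqAle eq_sym n0 ns_norm_ge0.
rewrite -ler_pdivrMr//; apply: ub_le_sup => //.
exists (ns_scale S (ns_norm S x)^-1 x).
  split; first exact: ns_memZ.
  by rewrite ns_normZ// gtr0_norm ?invr_gt0// mulVf.
by rewrite dual_formZ// normrM gtr0_norm ?invr_gt0// mulrC.
Qed.

Lemma dual_norm_le1P f : ns_mem (dual S) f ->
  dual_norm S f <= 1 <-> forall x, ns_mem S x -> `|f x| <= ns_norm S x.
Proof.
move=> mf; split=> [h x mx|h].
  apply: (le_trans (dual_norm_bound mf mx)).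
  by rewrite ler_piMl// ns_norm_ge0.
by apply: dual_norm_le => // x mx; rewrite mul1r; exact: h.
Qed.

Lemma dual_mem0 : ns_mem (dual S) (fun=> 0).
Proof.
split=> [a x y _ _|]; first by rewrite mulr0 addr0.
by exists 0 => x _; rewrite normr0 mul0r.
Qed.

Lemma dual_memD f g : ns_mem (dual S) f -> ns_mem (dual S) g ->
  ns_mem (dual S) (fun x => f x + g x).
Proof.
move=> [lf [c hc]] [lg [d hd]]; split.
  by move=> a x y mx my; rewrite lf// lg//; ring.
exists (c + d) => x mx; rewrite mulrDl.
by apply: (le_trans (ler_normD _ _)); apply: lerD; [exact: hc | exact: hd].
Qed.

Lemma dual_memZ a f : ns_mem (dual S) f -> ns_mem (dual S) (fun x => a * f x).
Proof.
move=> [lf [c hc]]; split.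
  by move=> b x y mx my; rewrite lf//; ring.
exists (`|a| * c) => x mx; rewrite normrM -mulrA.
by apply: ler_wpM2l => //; exact: hc.
Qed.

Lemma dual_mem_sum (I : finType) (f : I -> ns_car S -> R) :
  (forall i, ns_mem (dual S) (f i)) ->
  ns_mem (dual S) (fun x => \sum_i f i x).
Proof.
move=> mf.
have -> : (fun x => \sum_i f i x) = \big[ns_add (dual S)/fun=> 0]_i f i.
  apply/funext => x; apply/esym.
  by apply: (big_morph (fun f : ns_car S -> R => f x)).
by elim/big_ind: _ => //; [exact: dual_mem0 | exact: dual_memD].
Qed.

Lemma dual_normZ a f : ns_mem (dual S) f ->
  dual_norm S (fun x => a * f x) = `|a| * dual_norm S f.
Proof.
move=> mf; apply/le_anti/andP; split.
  apply: dual_norm_le; first by rewrite mulr_ge0// dual_norm_ge0.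
  by move=> x mx; rewrite normrM -mulrA ler_wpM2l// dual_norm_bound.
have [->|a0] := eqVneq a 0; first by rewrite normr0 mul0r dual_norm_ge0.
rewrite -ler_pdivlMl ?normr_gt0//; apply: dual_norm_le.
  by rewrite mulr_ge0 ?invr_ge0 ?dual_norm_ge0.
move=> x mx; rewrite -mulrA ler_pdivlMl ?normr_gt0// -normrM.
exact: (@dual_norm_bound (fun x => a * f x) x (dual_memZ a mf)).
Qed.

Lemma dual_ns_axioms : ns_axioms (dual S).
Proof.
split=> /=.
- exact: dual_mem0.
- exact: dual_memD.
- exact: dual_memZ.
- by move=> f; apply/funext => x; rewrite addr0.
- by move=> a; apply/funext => x; rewrite mulr0.
- by move=> f; apply/funext => x; rewrite mul1r.
- by move=> f _; exact: dual_norm_ge0.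
- exact: dual_normZ.
Qed.

Lemma eval_mem x : ns_mem S x ->
  ns_mem (dual (dual S)) (fun f : ns_car (dual S) => f x).
Proof.
move=> mx; split=> [//|]; exists (ns_norm S x) => f mf.
by rewrite mulrC; exact: dual_norm_bound.
Qed.

End Dual.

Lemma eval_norm_le1 S x : ns_axioms S -> ns_mem S x -> ns_norm S x <= 1 ->
  ns_norm (dual (dual S)) (fun f : ns_car (dual S) => f x) <= 1.
Proof.
move=> hS mx nx; apply: (dual_norm_le (dual_ns_axioms hS)) => // f mf.
rewrite mul1r; apply: (le_trans (dual_norm_bound hS mf mx)).
by rewrite ler_piMr// dual_norm_ge0.
Qed.

Definition weak_bound S r n (x : 'I_n -> ns_car S) M : Prop :=
  forall f, ns_mem (dual S) f -> ns_norm (dual S) f <= 1 ->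
    lnorm r n (fun i => f (x i)) <= M.

Lemma weak_bound_ge0 S r n (x : 'I_n -> ns_car S) M : ns_axioms S ->
  weak_bound r x M -> 0 <= M.
Proof.
move=> hS h; apply: le_trans (lnorm_ge0 r _) (h (fun=> 0) (dual_mem0 S) _).
apply: dual_norm_le => // x' mx'; rewrite normr0 mul1r.
exact: ns_norm_ge0.
Qed.

Lemma weak_bound_scale S r n (x : 'I_n -> ns_car S) M c : ns_axioms S ->
  (1 <= r)%E -> 0 <= c -> (forall i, ns_mem S (x i)) ->
  weak_bound r x M -> weak_bound r (fun i => ns_scale S c (x i)) (c * M).
Proof.
move=> hS r1 c0 mx h f mf nf.
under [fun i => _]funext => i do rewrite (dual_formZ hS c mf (mx i)).
by rewrite lnormZ// ger0_norm// ler_wpM2l//; exact: h.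
Qed.

Lemma le_mule_weak_normP S r n (x : 'I_n -> ns_car S) C X : ns_axioms S ->
  (1 <= r)%E -> 0 <= C -> (forall i, ns_mem S (x i)) ->
  (X <= C%:E * weak_norm S r x)%E <->
  forall M, weak_bound r x M -> (X <= (C * M)%:E)%E.
Proof.
move=> hS r1 C0 mx.
rewrite /weak_norm le_mule_ereal_supP//; last 2 first.
- exists (fun=> 0); split; first exact: dual_mem0.
  apply: dual_norm_le => // y my; rewrite normr0 mul1r; exact: ns_norm_ge0.
- exists (lnorm r n (fun i => ns_norm S (x i))) => f [mf nf].
  apply: ler_lnorm => // i; rewrite [leRHS]ger0_norm ?ns_norm_ge0//.
  exact: (iffLR (dual_norm_le1P hS mf) nf).
by split=> h M hM; apply: h => f; [case; exact: hM | move=> *; exact: hM].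
Qed.

(** Homogeneity in [fs]: dividing by a positive bound brings the family into the unit ball of the
    definition, and [ler_mul_of_gt0] covers [W = 0]. *)
Lemma cohen_norm_leP S r n (x : 'I_n -> ns_car S) K : ns_axioms S ->
  (1 <= r)%E -> 0 <= K ->
  (cohen_norm S r x <= K%:E)%E <->
  forall (fs : 'I_n -> ns_car (dual S)) W, 0 <= W ->
    (forall i, ns_mem (dual S) (fs i)) -> weak_bound (conj_exp r) fs W ->
    `|\sum_(i < n) fs i (x i)| <= K * W.
Proof.
move=> hS r1 K0; rewrite /cohen_norm ereal_sup_EFin_leP; split=> [h fs W W0 mfs hW|h fs].
  apply: ler_mul_of_gt0 => // V V0 WV.
  have := h (fun i y => V^-1 * fs i y); rewrite /ev.
  rewrite -mulr_sumr normrM gtr0_norm ?invr_gt0// ler_pdivrMl// mulrC.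
  apply; split=> [i|]; first exact: dual_memZ.
  apply/ereal_sup_EFin_leP => phi [mphi nphi].
  have := weak_bound_scale (dual_ns_axioms hS) (conj_exp_ge1 r1) _ mfs hW.
  move=> /(_ V^-1); rewrite invr_ge0 => /(_ (ltW V0)) /(_ phi mphi nphi) /le_trans; apply.
  by rewrite ler_pdivrMl// mulr1.
move=> [mfs] /ereal_sup_EFin_leP hfs; rewrite -[K]mulr1; apply: h => // phi mphi nphi.
exact: hfs.
Qed.

End Nspace.

(** * Summing norms tested on positive elements *)

Section Nlattice.
Local Set Implicit Arguments.
Local Unset Strict Implicit.
Context {R : realType}.
Implicit Type Z : nlattice R.

(** The last law removes the modulus that [pi_norm] takes of functionals already positive. *)
Record nl_axioms Z : Prop := NlAxioms {
  nl_ns : ns_axioms Z;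
  nl_abs_mem : forall z, ns_mem Z z -> ns_mem Z (nl_abs Z z);
  nl_dual_abs_pos : forall f y, ns_mem (dual Z) f -> nl_pos (dualL Z) f ->
    ns_mem Z y -> nl_pos Z y -> dual_abs Z f y = f y }.

Definition pos_weak_bound Z r n (z : 'I_n -> ns_car Z) M : Prop :=
  forall f, ns_mem (dual Z) f -> ns_norm (dual Z) f <= 1 -> nl_pos (dualL Z) f ->
    lnorm r n (fun i => f (z i)) <= M.

Definition pos_dual_bound Z r n (fs : 'I_n -> ns_car (dual Z)) M : Prop :=
  forall y, ns_mem Z y -> ns_norm Z y <= 1 -> nl_pos Z y ->
    lnorm r n (fun i => fs i y) <= M.

Lemma dual_pos0 Z : nl_pos (dualL Z) (fun=> 0).
Proof. by move=> x _ _. Qed.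

Lemma dual_posZ Z f c : 0 <= c -> nl_pos (dualL Z) f ->
  nl_pos (dualL Z) (fun x => c * f x).
Proof. by move=> c0 pf x mx px; rewrite /= mulr_ge0//; exact: pf. Qed.

Lemma pos_weak_bound_ge0 Z r n (z : 'I_n -> ns_car Z) M : ns_axioms Z ->
  pos_weak_bound r z M -> 0 <= M.
Proof.
move=> hS h; apply: le_trans (lnorm_ge0 r _) (h (fun=> 0) (dual_mem0 Z) _ (@dual_pos0 Z)).
apply: dual_norm_le => // x mx; rewrite normr0 mul1r.
exact: ns_norm_ge0.
Qed.

Lemma le_mule_abs_weak_normP Z r n (z : 'I_n -> ns_car Z) C X : nl_axioms Z ->
  (1 <= r)%E -> 0 <= C -> (forall i, ns_mem Z (z i)) ->
  (X <= C%:E * abs_weak_norm Z r z)%E <->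
  forall M, pos_weak_bound r (fun i => nl_abs Z (z i)) M -> (X <= (C * M)%:E)%E.
Proof.
move=> hZ r1 C0 mz; have hS := nl_ns hZ.
rewrite /abs_weak_norm le_mule_ereal_supP//; last 2 first.
- exists (fun=> 0); split; [exact: dual_mem0 | | exact: dual_pos0].
  apply: dual_norm_le => // y my; rewrite normr0 mul1r; exact: ns_norm_ge0.
- exists (lnorm r n (fun i => ns_norm Z (nl_abs Z (z i)))) => f [mf nf _].
  apply: ler_lnorm => // i.
  rewrite [leRHS]ger0_norm; last by apply: ns_norm_ge0 => //; exact: nl_abs_mem.
  by apply: (iffLR (dual_norm_le1P hS mf) nf); exact: nl_abs_mem.
split=> h M hM; apply: h => f; first by move=> [mf nf pf]; exact: hM.
by move=> mf nf pf; exact: hM.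
Qed.

Lemma pi_norm_leP Z r n (z : 'I_n -> ns_car Z) K : nl_axioms Z ->
  (1 <= r)%E -> r != 1%E -> 0 <= K ->
  (pi_norm Z r z <= K%:E)%E <->
  forall (fs : 'I_n -> ns_car (dual Z)) V, 0 <= V ->
    (forall i, ns_mem (dual Z) (fs i) /\ nl_pos (dualL Z) (fs i)) ->
    pos_dual_bound (conj_exp r) fs V ->
    \sum_(i < n) fs i (nl_abs Z (z i)) <= K * V.
Proof.
move=> hZ r1 /negbTE rn1 K0; rewrite /pi_norm rn1 ereal_sup_EFin_leP.
have absE (fs : 'I_n -> ns_car (dual Z)) y :
    (forall i, ns_mem (dual Z) (fs i) /\ nl_pos (dualL Z) (fs i)) ->
    ns_mem Z y -> nl_pos Z y ->
    (fun i => ev (nl_abs (dualL Z) (fs i)) y) = (fun i => fs i y).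
  move=> hfs my py; apply/funext => i; have [mf pf] := hfs i.
  exact: nl_dual_abs_pos.
split=> [h fs V V0 hfs hV|h fs [hfs /ereal_sup_EFin_leP hV]]; last first.
  rewrite -[K]mulr1; apply: h => // y my ny py.
  by rewrite -(absE fs y hfs my py); exact: hV.
apply: ler_mul_of_gt0 => // V' V'0 VV'.
have := h (fun i y => V'^-1 * fs i y); rewrite /ev.
rewrite -mulr_sumr ler_pdivrMl// mulrC; apply.
have hfs' i : ns_mem (dual Z) (fun y => V'^-1 * fs i y) /\
              nl_pos (dualL Z) (fun y => V'^-1 * fs i y).
  have [mf pf] := hfs i; split; first exact: dual_memZ.
  by apply: dual_posZ => //; rewrite invr_ge0 ltW.
split=> //; apply/ereal_sup_EFin_leP => y [my ny py].
rewrite (absE _ y hfs' my py) lnormZ ?conj_exp_ge1//.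
rewrite gtr0_norm ?invr_gt0// ler_pdivrMl// mulr1.
by apply: le_trans VV'; exact: hV.
Qed.

End Nlattice.

(** * Passing to the bidual *)

Lemma ler_of_add_invn {R : realType} (t a b : R) : 0 <= b ->
  (forall N, (0 < N)%N -> t <= a + b / N%:R) -> t <= a.
Proof.
move=> b0 h; apply/ler_addgt0Pr => e e0.
apply: (le_trans (h (Num.truncn (b / e)).+1 isT)); rewrite lerD2l.
rewrite ler_pdivrMr ?ltr0n// mulrC -ler_pdivrMr//.
by apply/ltW; have /andP[] := @Num.Theory.truncn_itv R (b / e) (divr_ge0 b0 (ltW e0)).
Qed.

Section ConeBidual.
Local Set Implicit Arguments.
Local Unset Strict Implicit.
Context {R : realType} {V : normedModType R}.

Lemma ns_of_axioms : ns_axioms (ns_of V).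
Proof.
split=> //=.
- by move=> x; rewrite addr0.
- by move=> a; rewrite scaler0.
- by move=> x; rewrite scale1r.
- by move=> a x _; rewrite normrZ.
Qed.

Lemma dual_linear_form f : ns_mem (dual (ns_of V)) f -> linear_form (f : V -> R).
Proof. by move=> [lf _] a x y; exact: lf. Qed.

Lemma linear_form_norm_le (f : V -> R) c : linear_form f ->
  (forall v, f v <= c * `|v|) -> forall v, `|f v| <= c * `|v|.
Proof.
move=> lf fc v; rewrite ler_norml fc andbT lerNl -(linear_formN lf).
by rewrite -[`|v|]normrN.
Qed.

Lemma linear_form_mem (f : V -> R) c : linear_form f ->
  (forall v, f v <= c * `|v|) -> ns_mem (dual (ns_of V)) f.
Proof.
move=> lf fc; split=> [a x y _ _|]; first exact: lf.
by exists c => v _; exact: linear_form_norm_le.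
Qed.

Lemma linear_form_norm_le1 (f : V -> R) : linear_form f ->
  (forall v, f v <= `|v|) -> ns_norm (dual (ns_of V)) f <= 1.
Proof.
move=> lf f1; apply: (dual_norm_le ns_of_axioms) => // v _.
by apply: linear_form_norm_le => // w; rewrite mul1r.
Qed.

(** [phi] is linear only on members of [dual S], so the induction over the index list carries
    membership of the partial sums along. *)
Lemma dual_dual_sum (S : nspace R) phi (I : finType) (a : I -> R)
    (f : I -> ns_car S -> R) :
  ns_mem (dual (dual S)) phi -> (forall i, ns_mem (dual S) (f i)) ->
  phi (fun v => \sum_i a i * f i v) = \sum_i a i * phi (f i).
Proof.
move=> mphi mf; pose F s := fun v => \sum_(i <- s) a i * f i v.
suff [] : ns_mem (dual S) (F (index_enum I)) /\
    phi (F (index_enum I)) = \sum_(i <- index_enum I) a i * phi (f i) by [].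
have phi0 : phi (fun=> 0) = 0.
  have := mphi.1 1 _ _ (dual_mem0 S) (dual_mem0 S).
  have -> : ns_add (dual S) (ns_scale (dual S) 1 (fun=> 0)) (fun=> 0) = fun=> 0.
    by apply/funext => v /=; rewrite mulr0 addr0.
  by rewrite mul1r; lra.
elim: (index_enum I) => [|i s [mF IH]].
  rewrite big_nil (_ : F [::] = fun=> 0); last by apply/funext => v; rewrite /F big_nil.
  by split; [exact: dual_mem0 | exact: phi0].
have -> : F (i :: s) = ns_add (dual S) (ns_scale (dual S) (a i) (f i)) (F s).
  by apply/funext => v; rewrite /F big_cons.
by split; [apply: dual_memD => //; exact: dual_memZ | rewrite mphi.1// big_cons IH].
Qed.

Variables (P : set V) (nu : V -> R) (n : nat) (r : \bar R).
Variables (g : 'I_n -> V -> R) (S : R).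
Hypotheses (cP : convex_cone P) (snu : sublinear nu) (nu0 : forall v, 0 <= nu v).
Hypothesis nu_norm : forall v, nu v <= `|v|.
Hypotheses (r1 : (1 <= r)%E) (S0 : 0 <= S).
Hypothesis mg : forall i, ns_mem (dual (ns_of V)) (g i).
Hypothesis hg : forall x M, (forall i, P (x i)) ->
  (forall h, linear_form h -> (forall v, h v <= nu v) ->
     lnorm r n (fun i => h (x i)) <= M) ->
  \sum_i g i (x i) <= S * M.

(* The bound on g passes from V to its bidual: up to epsilon, g is dominated on
   P by a finite combination of h's below nu with coefficients in the dual ball
   of [lnorm r], and phi can be applied to such a combination term by term. *)
Lemma cone_bidual_le (phi : 'I_n -> ns_car (dual (dual (ns_of V)))) M :
  (forall i, ns_mem (dual (dual (ns_of V))) (phi i)) ->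
  (forall i f f', ns_mem (dual (ns_of V)) f -> ns_mem (dual (ns_of V)) f' ->
     (forall v, P v -> f v <= f' v) -> phi i f <= phi i f') ->
  (forall h, linear_form h -> (forall v, h v <= nu v) ->
     lnorm r n (fun i => phi i h) <= M) ->
  \sum_i phi i (g i) <= S * M.
Proof.
move=> mphi monphi phiM.
have M0 : 0 <= M.
  apply: le_trans (lnorm_ge0 _ _) (phiM (fun=> 0) _ _) => // a x y.
  by rewrite mulr0 addr0.
have dS := dual_ns_axioms ns_of_axioms.
have gD i x y : P x -> P y -> g i (x + y) = g i x + g i y.
  by move=> _ _; exact: (linear_formD (dual_linear_form (mg i))).
have gZ i a x : 0 <= a -> P x -> g i (a *: x) = a * g i x.
  by move=> _ _; exact: (linear_formZ (dual_linear_form (mg i))).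
(* The error collects [S * n / N] from the grid and [1 / N] from the padding of the constants
   [c k]. *)
apply: (@ler_of_add_invn _ _ _ ((S * n%:R + 1) * M)).
  by rewrite mulr_ge0// addr_ge0// mulr_ge0.
move=> N N0; have N0R : 0 < N%:R :> R by rewrite ltr0n.
have [psi [lpsi psiS gpsi]] := cone_decomposition_grid cP snu nu0 r1 S0 gD gZ N0 hg.
pose K := {k : {ffun 'I_n -> 'I_N.+1 * bool} | `[< polar r (@grid_point R n N k) >]}.
set S' := S * _ in psiS.
(* [sup (A k)] is the norm of [psi k] relative to [nu]; as the vectors for different [k] are
   independent, these norms sum to at most [S']. *)
pose A (k : K) := [set psi k v | v in [set v | nu v <= 1]].
have A0 k : A k 0.
  exists 0; first by rewrite /= (sublinear0 snu).
  exact: (linear_form0 (lpsi k)).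
have [hA sumA] : (forall k, has_sup (A k)) /\ \sum_k sup (A k) <= S'.
  apply: sum_sup_le => [k|y Ay]; first by exists 0.
  have /choice[v hv] : forall k, exists v, nu v <= 1 /\ psi k v = y k.
    by move=> k; have [v v1 <-] := Ay k; exists v.
  have := psiS v 1 ler01 (fun k => (hv k).1); rewrite mulr1; apply: le_trans.
  by apply: ler_sum => k _; rewrite (hv k).2.
(* Padding by [d] makes every [c k] positive, hence invertible, and adds at most [N^-1] in total. *)
pose d : R := N%:R^-1 / #|{: K}|.+1%:R.
have d0 : 0 < d by rewrite divr_gt0 ?invr_gt0.
pose c k := sup (A k) + d.
have c0 k : 0 < c k.
  by rewrite ltr_wpDl//; apply: ub_le_sup (A0 k); exact: (hA k).2.
have psi_le k v : psi k v <= c k * nu v.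
  (* [nu] can vanish at a nonzero [v], as the norm of the positive part does on negative vectors;
     scaling is then impossible, but [psiS] with [m = 0] applies. *)
  have [v0|v0] := eqVneq (nu v) 0.
    rewrite v0 mulr0.
    have := psiS (fun j => if j == k then v else 0) 0 (lexx _).
    rewrite (bigD1 k)//= eqxx big1 => [|j /negbTE ->]; last first.
      exact: (linear_form0 (lpsi j)).
    rewrite addr0 mulr0; apply=> j.
    by case: eqP; rewrite ?v0 ?(sublinear0 snu).
  have v1 : 0 < nu v by rewrite lt_neqAle eq_sym v0 nu0.
  rewrite -ler_pdivrMr// mulrC -(linear_formZ (lpsi k)).
  apply: (@le_trans _ _ (sup (A k))); last by rewrite lerDl ltW.
  apply: ub_le_sup; first exact: (hA k).2.
  exists ((nu v)^-1 *: v) => //=.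
  by rewrite snu.2 ?invr_ge0// mulVf.
have mpsi k : ns_mem (dual (ns_of V)) (psi k).
  apply: (@linear_form_mem _ (c k)) => // v; apply: (le_trans (psi_le k v)).
  by rewrite ler_pM2l.
apply: (@le_trans _ _ (\sum_i phi i (fun v => \sum_k grid_point (val k) i * psi k v))).
  apply: ler_sum => i _; apply: monphi => //; last exact: gpsi.
  by apply: dual_mem_sum => k; exact: dual_memZ.
have phi_sum i : phi i (fun v => \sum_k grid_point (val k) i * psi k v) =
    \sum_k grid_point (val k) i * phi i (psi k).
  exact: dual_dual_sum.
under eq_bigr => i _ do rewrite phi_sum.
rewrite exchange_big /=.
apply: (@le_trans _ _ (\sum_k c k * M)).
  (* The grid point lies in the dual ball, so the inner sum is at most [lnorm r] of the
     [phi i (psi k)], and [psi k] divided by [c k] is a form below [nu]. *)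
  apply: ler_sum => k _; have /asboolP pk := valP k.
  apply: (le_trans (pk _)).
  rewrite -ler_pdivrMl//.
  have -> : (fun i => phi i (psi k)) = (fun i => c k * phi i (fun v => (c k)^-1 * psi k v)).
    apply/funext => i; have := dual_formZ dS (c k)^-1 (mphi i) (mpsi k).
    by move=> /= ->; rewrite mulVKf// gt_eqF.
  rewrite lnormZ// gtr0_norm// mulKf ?gt_eqF//; apply: phiM.
    by move=> a x y; rewrite lpsi; ring.
  by move=> v; rewrite ler_pdivrMl.
rewrite -mulr_suml big_split /= sumr_const.
have h : d *+ #|{: K}| <= N%:R^-1.
  by rewrite -[leLHS]mulr_natr /d mulrAC ler_pdivrMr// ler_pM2l ?invr_gt0// ler_nat.
apply: (@le_trans _ _ ((S' + N%:R^-1) * M)).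
  by apply: ler_wpM2r => //; exact: lerD.
by rewrite /S' le_eqVlt; apply/orP; left; apply/eqP; field; rewrite gt_eqF.
Qed.

End ConeBidual.

(** * Banach lattices *)

Section BanachLattice.
Local Set Implicit Arguments.
Local Unset Strict Implicit.
Context {R : realType} {V : completeNormedModType R} {L : lat_data V}.
Hypothesis hL : is_banach_lattice V L.

Local Notation "x <=l y" := (ld_le L x y) (at level 70).
Local Notation abs := (ld_abs L).
Local Notation Z := (nl_of V L).

Lemma lat_refl x : x <=l x. Proof. by have [[]] := hL. Qed.
Lemma lat_anti x y : x <=l y -> y <=l x -> x = y.
Proof. by have [[_ h _ _ _] _] := hL; exact: h. Qed.
Lemma lat_trans y x z : x <=l y -> y <=l z -> x <=l z.
Proof. by have [[_ _ h _ _] _] := hL; exact: h. Qed.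
Lemma lat_add2r z x y : x <=l y -> x + z <=l y + z.
Proof. by have [[_ _ _ h _] _] := hL; exact: h. Qed.
Lemma lat_scale a x y : 0 <= a -> x <=l y -> a *: x <=l a *: y.
Proof. by have [[_ _ _ _ h] _] := hL; exact: h. Qed.
Lemma lat_sup x y : exists s, [/\ x <=l s, y <=l s &
  forall u, x <=l u -> y <=l u -> s <=l u].
Proof. by have [_ [h _ _]] := hL; exact: h. Qed.
Lemma lat_le_abs x : x <=l abs x.
Proof. by have [_ [_ h _]] := hL; have [] := h x. Qed.
Lemma lat_opp_le_abs x : - x <=l abs x.
Proof. by have [_ [_ h _]] := hL; have [] := h x. Qed.
Lemma lat_abs_le x u : x <=l u -> - x <=l u -> abs x <=l u.
Proof. by have [_ [_ h _]] := hL; have [_ _] := h x; exact. Qed.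
Lemma lat_norm_le x y : abs x <=l abs y -> `|x| <= `|y|.
Proof. by have [_ [_ _ h]] := hL; exact: h. Qed.

Lemma lat_leD a b c d : a <=l b -> c <=l d -> a + c <=l b + d.
Proof.
move=> ab cd; apply: (@lat_trans (b + c)); first exact: lat_add2r.
by rewrite [b + c]addrC [b + d]addrC; exact: lat_add2r.
Qed.

Lemma lat_sub_ge0 x y : (0 <=l y - x) <-> x <=l y.
Proof.
split=> h; first by have := lat_add2r x h; rewrite add0r subrK.
by have := lat_add2r (- x) h; rewrite subrr.
Qed.

Lemma lat_leN x y : x <=l y -> - y <=l - x.
Proof.
by move=> h; apply/lat_sub_ge0; rewrite opprK addrC; apply/lat_sub_ge0.
Qed.

Lemma lat_leBl x y z : (x - z <=l y) <-> x <=l y + z.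
Proof.
split=> h; first by have := lat_add2r z h; rewrite subrK.
by have := lat_add2r (- z) h; rewrite addrK.
Qed.

Lemma lat_addr_ge0 x y : 0 <=l x -> 0 <=l y -> 0 <=l x + y.
Proof. by move=> x0 y0; have := lat_leD x0 y0; rewrite addr0. Qed.

Lemma lat_scale_ge0 a x : 0 <= a -> 0 <=l x -> 0 <=l a *: x.
Proof. by move=> a0 x0; rewrite -(scaler0 _ a); exact: lat_scale. Qed.

Lemma lat_half (x : V) : x = 2^-1 *: (x + x).
Proof. by rewrite -mulr2n -[x *+ 2]scaler_nat scalerA mulVf ?scale1r// pnatr_eq0. Qed.

Lemma lat_abs_ge0 x : 0 <=l abs x.
Proof.
rewrite [abs x]lat_half; apply: lat_scale_ge0; first by rewrite invr_ge0.
by rewrite -(subrr x); apply: lat_leD; [exact: lat_le_abs | exact: lat_opp_le_abs].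
Qed.

Lemma lat_abs_pos x : 0 <=l x -> abs x = x.
Proof.
move=> x0; apply: lat_anti; last exact: lat_le_abs.
apply: lat_abs_le; first exact: lat_refl.
by have := lat_leN x0; rewrite oppr0 => /lat_trans; exact.
Qed.

Lemma lat_abs_abs x : abs (abs x) = abs x.
Proof. by apply: lat_abs_pos; exact: lat_abs_ge0. Qed.

Lemma lat_abs0 : abs 0 = 0.
Proof. by apply: lat_abs_pos; exact: lat_refl. Qed.

Lemma lat_absD x y : abs (x + y) <=l abs x + abs y.
Proof.
apply: lat_abs_le; first by apply: lat_leD; exact: lat_le_abs.
by rewrite opprD; apply: lat_leD; exact: lat_opp_le_abs.
Qed.

Lemma lat_absZ_le a x : 0 <= a -> abs (a *: x) <=l a *: abs x.
Proof.
move=> a0; apply: lat_abs_le; first by apply: lat_scale => //; exact: lat_le_abs.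
by rewrite -scalerN; apply: lat_scale => //; exact: lat_opp_le_abs.
Qed.

Lemma lat_absZ a x : 0 <= a -> abs (a *: x) = a *: abs x.
Proof.
rewrite le_eqVlt => /predU1P[<-|a0]; first by rewrite !scale0r lat_abs0.
apply: lat_anti; first by apply: lat_absZ_le; exact: ltW.
have := @lat_absZ_le a^-1 (a *: x); rewrite invr_ge0 => /(_ (ltW a0)) h.
have := lat_scale (ltW a0) h.
by rewrite !scalerA mulVf ?mulfV ?scale1r// gt_eqF.
Qed.

Lemma lat_absN x : abs (- x) = abs x.
Proof.
have h y : abs (- y) <=l abs y.
  apply: lat_abs_le; first exact: lat_opp_le_abs.
  by rewrite opprK; exact: lat_le_abs.
by apply: lat_anti => //; rewrite -{1}[x]opprK.
Qed.

Lemma lat_norm_abs x : `|abs x| = `|x|.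
Proof.
by apply/le_anti/andP; split; apply: lat_norm_le; rewrite lat_abs_abs; exact: lat_refl.
Qed.

Lemma lat_norm_mono x y : 0 <=l x -> x <=l y -> `|x| <= `|y|.
Proof.
move=> x0 xy; apply: lat_norm_le; rewrite !lat_abs_pos//.
exact: lat_trans xy.
Qed.

Lemma lat_norm_le_abs x y : abs x <=l y -> `|x| <= `|y|.
Proof. by rewrite -(lat_norm_abs x); apply: lat_norm_mono; exact: lat_abs_ge0. Qed.

Definition pospart (x : V) : V := ppart Z x.

Lemma pospartE x : pospart x = 2^-1 *: (abs x + x). Proof. by []. Qed.

Lemma npartE x : npart Z x = pospart (- x).
Proof. by rewrite pospartE lat_absN /npart /nl_sub /= scaleN1r. Qed.

Lemma pospart_ge0 x : 0 <=l pospart x.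
Proof.
rewrite pospartE; apply: lat_scale_ge0; first by rewrite invr_ge0.
by rewrite -(addNr x); apply: lat_add2r; exact: lat_opp_le_abs.
Qed.

Lemma pospart_decomp x : pospart x - pospart (- x) = x.
Proof.
rewrite !pospartE lat_absN -scalerBr opprD opprK addrACA subrr add0r.
by rewrite -lat_half.
Qed.

Lemma pospart_abs x : pospart x + pospart (- x) = abs x.
Proof.
by rewrite !pospartE lat_absN -scalerDr addrACA subrr addr0 -lat_half.
Qed.

Lemma le_pospart x : x <=l pospart x.
Proof.
by apply/lat_sub_ge0; rewrite -{2}(pospart_decomp x) opprB addrC subrK; exact: pospart_ge0.
Qed.

Lemma pospart_le_abs x : pospart x <=l abs x.
Proof. by apply/lat_sub_ge0; rewrite -pospart_abs addrC addKr; exact: pospart_ge0. Qed.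

Lemma pospart_pos x : 0 <=l x -> pospart x = x.
Proof. by move=> x0; rewrite pospartE lat_abs_pos// -lat_half. Qed.

Lemma pospart_neg x : 0 <=l x -> pospart (- x) = 0.
Proof. by move=> x0; rewrite pospartE lat_absN lat_abs_pos// subrr scaler0. Qed.

(** The linear forms below this functional are exactly the positive functionals of norm at most 1,
    so Hahn--Banach under it returns positive functionals. *)
Definition norm_pospart (x : V) : R := `|pospart x|.

Lemma norm_pospart_ge0 x : 0 <= norm_pospart x. Proof. exact: normr_ge0. Qed.

Lemma norm_pospart_le_norm x : norm_pospart x <= `|x|.
Proof.
rewrite -(lat_norm_abs x); apply: lat_norm_mono; first exact: pospart_ge0.
exact: pospart_le_abs.
Qed.

Lemma norm_pospart_pos x : 0 <=l x -> norm_pospart x = `|x|.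
Proof. by move=> x0; rewrite /norm_pospart pospart_pos. Qed.

Lemma norm_pospart_sublinear : sublinear norm_pospart.
Proof.
split=> [x y|a x a0].
  apply: (@le_trans _ _ `|pospart x + pospart y|); last exact: ler_normD.
  apply: lat_norm_mono; first exact: pospart_ge0.
  rewrite !pospartE -scalerDr; apply: lat_scale; first by rewrite invr_ge0.
  by rewrite addrACA; apply: lat_add2r; exact: lat_absD.
rewrite /norm_pospart !pospartE lat_absZ// -scalerDr scalerA mulrC -scalerA normrZ.
by rewrite ger0_norm.
Qed.

Lemma convex_cone_pos : convex_cone [set x | 0 <=l x].
Proof.
split=> [|x y|a x a0]; [exact: lat_refl | exact: lat_addr_ge0 | exact: lat_scale_ge0].
Qed.

Lemma dual_mono f x y : ns_mem (dual Z) f -> nl_pos (dualL Z) f ->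
  x <=l y -> f x <= f y.
Proof.
move=> mf pf xy; rewrite -subr_ge0 -(linear_formB (dual_linear_form mf)).
by apply: pf => //; apply/lat_sub_ge0.
Qed.

(** Negative vectors have positive part 0, which forces [f] to be positive. *)
Lemma linear_form_le_norm_pospart f : linear_form f -> (forall x, f x <= norm_pospart x) ->
  [/\ ns_mem (dual Z) f, ns_norm (dual Z) f <= 1 & nl_pos (dualL Z) f].
Proof.
move=> lf fnu; have f1 x : f x <= `|x| by exact: le_trans (norm_pospart_le_norm x).
split.
- by apply: (@linear_form_mem _ _ _ 1) => // x; rewrite mul1r.
- exact: linear_form_norm_le1.
- move=> x _ px; rewrite /= -oppr_le0 -(linear_formN lf).
  by apply: (le_trans (fnu _)); rewrite /norm_pospart pospart_neg// normr0.
Qed.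

Lemma pos_dual_le_norm_pospart f : ns_mem (dual Z) f -> ns_norm (dual Z) f <= 1 ->
  nl_pos (dualL Z) f -> forall x, f x <= norm_pospart x.
Proof.
move=> mf nf pf x; apply: (@le_trans _ _ (f (pospart x))).
  by apply: dual_mono => //; exact: le_pospart.
apply: (le_trans (ler_norm _)).
exact: (iffLR (dual_norm_le1P (@ns_of_axioms R V) mf) nf).
Qed.

(** [y1] is [y] truncated to the interval from [- u] to [u]. Only suprema being given, the infimum
    of [y] and [u] is obtained as [- s], with [s] the supremum of [- y] and [- u]. *)
Lemma riesz_decomposition y u v : 0 <=l u -> 0 <=l v -> abs y <=l u + v ->
  exists y1 y2, [/\ y = y1 + y2, abs y1 <=l u & abs y2 <=l v].
Proof.
move=> u0 v0 yuv.
have hy : y <=l u + v by apply: lat_trans yuv; exact: lat_le_abs.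
have hNy : - y <=l u + v by apply: lat_trans yuv; exact: lat_opp_le_abs.
have Nu_u : - u <=l u by have := lat_leN u0; rewrite oppr0 => /lat_trans; exact.
have [s [sy su smin]] := lat_sup (- y) (- u).
have my : - s <=l y by have := lat_leN sy; rewrite opprK.
have mu : - s <=l u by have := lat_leN su; rewrite opprK.
have [y1 [my1 uy1 y1min]] := lat_sup (- s) (- u).
exists y1, (y - y1); split; first by rewrite addrC subrK.
- apply: lat_abs_le; first exact: y1min.
  by have := lat_leN uy1; rewrite opprK.
- apply: lat_abs_le.
    apply/lat_leBl; rewrite addrC; apply/lat_leBl; apply: lat_trans my1.
    rewrite -[y - v]opprK; apply: lat_leN; apply: smin.
      apply: lat_leN; apply/lat_leBl; rewrite -{1}[y]addr0.
      by apply: lat_leD => //; exact: lat_refl.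
    by apply: lat_leN; apply/lat_leBl.
  rewrite opprB; apply/lat_leBl; apply: y1min.
    by apply: (lat_trans my); rewrite -{1}[y]add0r; apply: lat_leD => //; exact: lat_refl.
  by have := lat_leN hNy; rewrite opprK => h; rewrite addrC; apply/lat_leBl; rewrite -opprD.
Qed.

End BanachLattice.

(** * The modulus of a functional *)

Section DualLattice.
Local Set Implicit Arguments.
Local Unset Strict Implicit.
Context {R : realType} {V : completeNormedModType R} {L : lat_data V}.
Hypothesis hL : is_banach_lattice V L.

Local Notation "x <=l y" := (ld_le L x y) (at level 70).
Local Notation abs := (ld_abs L).
Local Notation Z := (nl_of V L).
Local Notation dabs f := (dual_abs Z f).
Local Notation rk f := (rk_sup Z f).

Let nsZ : ns_axioms Z. Proof. exact: ns_of_axioms. Qed.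

Section RieszKantorovich.
Variable f : V -> R.
Hypothesis mf : ns_mem (dual Z) f.

Let lf : linear_form f. Proof. exact: dual_linear_form. Qed.

Lemma dual_norm_bound_of x : `|f x| <= dual_norm Z f * `|x|.
Proof. exact: (dual_norm_bound nsZ). Qed.

Lemma rk_ubound u y : abs y <=l u -> f y <= dual_norm Z f * `|u|.
Proof.
move=> yu; apply: (le_trans (ler_norm _)); apply: (le_trans (dual_norm_bound_of _)).
apply: ler_wpM2l (lat_norm_le_abs hL yu).
exact: dual_norm_ge0.
Qed.

Lemma rk_ge u y : abs y <=l u -> f y <= rk f u.
Proof.
move=> yu; apply: ub_le_sup; last by exists y.
by exists (dual_norm Z f * `|u|) => _ [z [_ zu] <-]; exact: rk_ubound.
Qed.

Lemma rk_le u t : 0 <=l u -> (forall y, abs y <=l u -> f y <= t) -> rk f u <= t.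
Proof.
move=> u0 h; apply: ge_sup; last by move=> _ [z [_ zu] <-]; exact: h.
by exists (f 0), 0 => //; split=> //=; rewrite lat_abs0.
Qed.

Lemma rk_ge0 u : 0 <=l u -> 0 <= rk f u.
Proof. by move=> u0; rewrite -(linear_form0 lf); apply: rk_ge; rewrite lat_abs0. Qed.

Lemma rk_le_norm u : 0 <=l u -> rk f u <= dual_norm Z f * `|u|.
Proof. by move=> u0; apply: rk_le => // y; exact: rk_ubound. Qed.

(** Riesz decomposition splits every competitor for [u + v]; conversely competitors for [u] and [v]
    add up to one for [u + v]. *)
Lemma rkD u v : 0 <=l u -> 0 <=l v -> rk f (u + v) = rk f u + rk f v.
Proof.
move=> u0 v0; apply/le_anti/andP; split.
  apply: rk_le; first exact: lat_addr_ge0.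
  move=> y yuv; have [y1 [y2 [-> y1u y2v]]] := riesz_decomposition hL u0 v0 yuv.
  by rewrite (linear_formD lf); apply: lerD; exact: rk_ge.
rewrite -lerBrDr; apply: rk_le => // y1 y1u; rewrite lerBrDr -lerBrDl.
apply: rk_le => // y2 y2v; rewrite lerBrDl -(linear_formD lf); apply: rk_ge.
by apply: (lat_trans hL (lat_absD hL _ _)); exact: lat_leD.
Qed.

Lemma rkZ_le a u : 0 < a -> 0 <=l u -> a * rk f u <= rk f (a *: u).
Proof.
move=> a0 u0; rewrite -ler_pdivlMl//; apply: rk_le => // y yu.
rewrite ler_pdivlMl// -(linear_formZ lf); apply: rk_ge.
by rewrite lat_absZ ?ltW//; apply: lat_scale => //; exact: ltW.
Qed.

Lemma rk0 : rk f 0 = 0.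
Proof. by have := rkD (lat_refl hL 0) (lat_refl hL 0); rewrite addr0; lra. Qed.

Lemma rkZ a u : 0 <= a -> 0 <=l u -> rk f (a *: u) = a * rk f u.
Proof.
rewrite le_eqVlt => /predU1P[<-|a0] u0; first by rewrite scale0r rk0 mul0r.
apply/le_anti/andP; split; last exact: rkZ_le.
have := @rkZ_le a^-1 (a *: u); rewrite invr_gt0 scalerA mulVf ?gt_eqF// scale1r.
by move=> /(_ a0 (lat_scale_ge0 hL (ltW a0) u0)); rewrite ler_pdivrMl.
Qed.

Lemma dual_absE x : dabs f x = rk f (pospart (L := L) x) - rk f (pospart (L := L) (- x)).
Proof. by rewrite /dual_abs (npartE hL). Qed.

Lemma dual_abs_pos u : 0 <=l u -> dabs f u = rk f u.
Proof.
by move=> u0; rewrite dual_absE (pospart_pos hL u0) (pospart_neg hL u0) rk0 subr0.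
Qed.

(** The value does not depend on how a vector is written as a difference of positive ones, since
    [p + v = u + q] and [rk f] is additive; positive parts of sums need never be compared. *)
Lemma dual_absB u v : 0 <=l u -> 0 <=l v -> dabs f (u - v) = rk f u - rk f v.
Proof.
move=> u0 v0; rewrite dual_absE.
set p := pospart _; set q := pospart _.
have p0 : 0 <=l p by exact: pospart_ge0.
have q0 : 0 <=l q by exact: pospart_ge0.
have pq : p - q = u - v by exact: pospart_decomp.
have : p + v = u + q by rewrite -(subrK q p) pq addrAC subrK.
by move/(congr1 (rk f)); rewrite !rkD//; lra.
Qed.

Lemma dual_absD x y : dabs f (x + y) = dabs f x + dabs f y.
Proof.
rewrite -{1}(pospart_decomp hL x) -{1}(pospart_decomp hL y) addrACA -opprD.
rewrite dual_absB; [|exact/(lat_addr_ge0 hL)/pospart_ge0/hL/pospart_ge0..].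
by rewrite !rkD ?dual_absE; [ring|exact: pospart_ge0..].
Qed.

Lemma dual_absN x : dabs f (- x) = - dabs f x.
Proof. by rewrite !dual_absE opprK opprB. Qed.

Lemma dual_abs_linear : linear_form (dabs f).
Proof.
have pZ a x : 0 <= a -> dabs f (a *: x) = a * dabs f x.
  move=> a0; rewrite -{1}(pospart_decomp hL x) scalerBr.
  rewrite dual_absB; [|by apply: lat_scale_ge0 => //; exact: pospart_ge0..].
  rewrite (rkZ a0 (pospart_ge0 hL x)) (rkZ a0 (pospart_ge0 hL (- x))).
  by rewrite dual_absE mulrBr.
move=> a x y; rewrite dual_absD; congr (_ + _).
have [a0|a0] := leP 0 a; first exact: pZ.
by rewrite -[a]opprK scaleNr dual_absN pZ ?mulNr// oppr_ge0 ltW.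
Qed.

Lemma dual_abs_mem : ns_mem (dual Z) (dabs f).
Proof.
apply: (@linear_form_mem _ _ _ (dual_norm Z f)); first exact: dual_abs_linear.
move=> x; apply: (@le_trans _ _ (rk f (abs x))).
  rewrite -(pospart_abs hL) rkD; [|exact: pospart_ge0..].
  rewrite dual_absE lerD2l; have := rk_ge0 (pospart_ge0 hL (- x)); lra.
rewrite -(lat_norm_abs hL x); apply: rk_le_norm; exact: lat_abs_ge0.
Qed.

Lemma dual_abs_ge0 : nl_pos (dualL Z) (dabs f).
Proof. by move=> x _ px; rewrite /= dual_abs_pos//; exact: rk_ge0. Qed.

Lemma norm_le_dual_abs x : `|f x| <= dabs f (abs x).
Proof.
rewrite dual_abs_pos; last exact: lat_abs_ge0.
rewrite ler_norml lerNl -(linear_formN lf); apply/andP; split; apply: rk_ge.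
  by rewrite lat_absN//; exact: lat_refl.
exact: lat_refl.
Qed.

Lemma dual_abs_le h : ns_mem (dual Z) h -> nl_pos (dualL Z) h ->
  (forall x, f x <= h (abs x)) -> dual_le Z (dabs f) h.
Proof.
move=> mh ph fh u _ u0; rewrite dual_abs_pos//; apply: rk_le => // y yu.
apply: (le_trans (fh y)); exact: (dual_mono hL).
Qed.

Lemma dual_abs_id : nl_pos (dualL Z) f -> dabs f = f.
Proof.
move=> pf.
have rkf u : 0 <=l u -> rk f u = f u.
  move=> u0; apply/le_anti/andP; split.
    apply: rk_le => // y yu; apply: (dual_mono hL) => //.
    exact: (lat_trans hL (lat_le_abs hL y) yu).
  by apply: rk_ge; rewrite lat_abs_pos//; exact: lat_refl.
apply/funext => x; rewrite dual_absE !rkf; [|exact: pospart_ge0..].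
by rewrite -(linear_formB lf) pospart_decomp.
Qed.

End RieszKantorovich.

(** Hahn--Banach at [y] under the sublinear functional sending [x] to [f (abs x)]; a form below it
    has modulus at most [f] by [dual_abs_le]. *)
Lemma exists_dual_abs_le f y : ns_mem (dual Z) f -> nl_pos (dualL Z) f ->
  exists g, [/\ ns_mem (dual Z) g, g y = f (abs y) & dual_le Z (dabs g) f].
Proof.
move=> mf pf; have lf := dual_linear_form mf.
have sp : sublinear (fun x => f (abs x)).
  split=> [x z|a x a0]; last by rewrite (lat_absZ hL)// (linear_formZ lf).
  by rewrite -(linear_formD lf); apply: (dual_mono hL) => //; exact: lat_absD.
have [g [lg gf gy]] := hahn_banach_at y sp.
have mg : ns_mem (dual Z) g.
  apply: (@linear_form_mem _ _ _ (dual_norm Z f)) => // v.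
  apply: (le_trans (gf v)); apply: (le_trans (ler_norm _)).
  by apply: (le_trans (dual_norm_bound_of mf _)); rewrite lat_norm_abs.
by exists g; split=> //; exact: dual_abs_le.
Qed.

Lemma exists_norming y : exists f, [/\ ns_mem (dual Z) f,
  ns_norm (dual Z) f <= 1, nl_pos (dualL Z) f & f (abs y) = `|y|].
Proof.
have [f [lf fnu fy]] := hahn_banach_at (abs y) (norm_pospart_sublinear hL).
have [mf nf pf] := linear_form_le_norm_pospart hL lf fnu.
exists f; split=> //; rewrite fy norm_pospart_pos//; last exact: lat_abs_ge0.
exact: lat_norm_abs.
Qed.

Lemma bidual_mono phi f h : ns_mem (dual (dual Z)) phi ->
  nl_pos (dualL (dualL Z)) phi -> ns_mem (dual Z) f -> ns_mem (dual Z) h ->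
  dual_le Z f h -> phi f <= phi h.
Proof.
move=> mphi pphi mf mh fh; have dS := dual_ns_axioms nsZ.
have mf' := dual_memZ (-1) mf.
rewrite -subr_ge0 -[- phi f]mulN1r -(dual_formZ dS _ mphi mf).
rewrite -(dual_formD dS mphi mh mf'); apply: (pphi _ (dual_memD mh mf')).
by move=> x mx px /=; rewrite mulN1r subr_ge0; exact: fh.
Qed.

Lemma nl_of_axioms : nl_axioms Z.
Proof. by split=> // f y mf pf _ _; rewrite dual_abs_id. Qed.

(** For the last law, a positive [g] is its own positive part, and by monotonicity the
    Riesz--Kantorovich supremum of [phi] at [g] is attained at [g]. *)
Lemma dualL_axioms : nl_axioms (dualL Z).
Proof.
split=> [||phi g mphi pphi mg pg].
- exact: dual_ns_axioms.
- by move=> f mf; exact: dual_abs_mem.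
- have gE : ppart (dualL Z) g = g.
    apply/funext => x; rewrite /ppart /= dual_abs_id//.
    by lra.
  have g0 : npart (dualL Z) g = fun=> 0.
    apply/funext => x; rewrite /npart /nl_sub /= dual_abs_id//.
    by rewrite mulN1r subrr mulr0.
  have rkE h : ns_mem (dual Z) h -> nl_pos (dualL Z) h ->
      rk_sup (dualL Z) phi h = phi h.
    move=> mh ph.
    have phi_le k : ns_mem (dual Z) k -> dual_le Z (dabs k) h -> phi k <= phi h.
      move=> mk kh; apply: bidual_mono => // x mx px.
      apply: le_trans (kh x mx px); apply: (le_trans (ler_norm _)).
      by have := norm_le_dual_abs mk x; rewrite lat_abs_pos.
    have hh : dual_le Z (dabs h) h by move=> x _ _; rewrite dual_abs_id.
    apply/le_anti/andP; split.
      apply: ge_sup; first by exists (phi h), h.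
      by move=> _ [k [mk kh] <-]; exact: phi_le.
    apply: ub_le_sup; last by exists h.
    by exists (phi h) => _ [k [mk kh] <-]; exact: phi_le.
  rewrite /dual_abs gE g0 !rkE//; last exact: dual_mem0.
  by rewrite (dual_form0 (dual_ns_axioms nsZ) mphi) subr0.
Qed.

End DualLattice.

(** * Families in the bidual *)

Lemma pos_dual_bound_norm {R : realType} (Z : nlattice R) (r : \bar R) n
    (fs : 'I_n -> ns_car (dual Z)) V y :
  ns_axioms Z -> (1 <= r)%E ->
  (forall a x, 0 <= a -> nl_pos Z x -> nl_pos Z (ns_scale Z a x)) ->
  (forall i, ns_mem (dual Z) (fs i)) -> pos_dual_bound r fs V ->
  ns_mem Z y -> nl_pos Z y -> lnorm r n (fun i => fs i y) <= V * ns_norm Z y.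
Proof.
move=> hS r1 posZ mfs hV my py.
have [n0|n0] := eqVneq (ns_norm Z y) 0.
  rewrite n0 mulr0 (_ : (fun i => fs i y) = fun=> 0 * 0).
    by rewrite lnormZ// normr0 mul0r.
  apply/funext => i; rewrite mulr0; apply/normr0_eq0/le_anti; rewrite normr_ge0 andbT.
  by apply: (le_trans (dual_norm_bound hS (mfs i) my)); rewrite n0 mulr0.
have npos : 0 < ns_norm Z y by rewrite lt_neqAle eq_sym n0 ns_norm_ge0.
rewrite mulrC -ler_pdivrMl//.
have -> : (ns_norm Z y)^-1 * lnorm r n (fun i => fs i y) =
    lnorm r n (fun i => fs i (ns_scale Z (ns_norm Z y)^-1 y)).
  rewrite -[X in X * _]gtr0_norm ?invr_gt0// -lnormZ//; congr lnorm.
  by apply/funext => i; rewrite dual_formZ.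
apply: hV; first exact: ns_memZ.
  by rewrite ns_normZ// gtr0_norm ?invr_gt0// mulVf.
by apply: posZ => //; rewrite invr_ge0 ltW.
Qed.

Section LatticeBidual.
Local Set Implicit Arguments.
Local Unset Strict Implicit.
Context {R : realType} {V : completeNormedModType R} {L : lat_data V}.
Hypothesis hL : is_banach_lattice V L.
Variables (n : nat) (r : \bar R).
Hypothesis r1 : (1 <= r)%E.

Local Notation "x <=l y" := (ld_le L x y) (at level 70).
Local Notation abs := (ld_abs L).
Local Notation Z := (nl_of V L).
Local Notation dabs f := (dual_abs Z f).

Let nsZ : ns_axioms Z. Proof. exact: ns_of_axioms. Qed.

Lemma pos_dual_bound_normr (f : 'I_n -> ns_car (dual Z)) M y :
  (forall i, ns_mem (dual Z) (f i)) -> pos_dual_bound r f M -> 0 <=l y ->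
  lnorm r n (fun i => f i y) <= M * `|y|.
Proof.
move=> mf hM py; apply: (@pos_dual_bound_norm R Z) => // a x a0 px.
exact: lat_scale_ge0.
Qed.

(** Each modulus is a supremum over vectors [y i] chosen independently of one another, so
    [sum_sup_le] applies. *)
Lemma sum_dual_abs_le (f : 'I_n -> V -> R) x K :
  (forall i, ns_mem (dual Z) (f i)) -> (forall i, 0 <=l x i) ->
  (forall y, (forall i, abs (y i) <=l x i) -> \sum_i f i (y i) <= K) ->
  \sum_i dabs (f i) (x i) <= K.
Proof.
move=> mf px h.
pose A i := [set f i y | y in [set y | ns_mem Z y /\ nl_le Z (nl_abs Z y) (x i)]].
under eq_bigr => i _ do rewrite (dual_abs_pos hL (mf i) (px i)).
apply: (proj2 (@sum_sup_le R _ A K _ _)) => [i|t At].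
  by exists (f i 0), 0 => //; split=> //=; rewrite lat_abs0.
have /choice[y hy] : forall i, exists y, abs y <=l x i /\ f i y = t i.
  by move=> i; have [y [_ yx] <-] := At i; exists y.
rewrite -(eq_bigr _ (fun i _ => (hy i).2)).
by apply: h => i; have [] := hy i.
Qed.

(** [cone_bidual_le] is applied to the moduli of the [f i], with the positive cone and
    [norm_pospart]. The hypothesis on [f] suffices because vectors [y i] of modulus at most [x i]
    inherit the weak bounds of [x]. *)
Lemma sum_bidual_dual_abs_le (f : 'I_n -> V -> R)
    (phi : 'I_n -> ns_car (dual (dual Z))) S M :
  0 <= S -> (forall i, ns_mem (dual Z) (f i)) ->
  (forall i, ns_mem (dual (dual Z)) (phi i) /\ nl_pos (dualL (dualL Z)) (phi i)) ->
  (forall y M', 0 <= M' -> pos_weak_bound (Z := Z) r (fun i => abs (y i)) M' ->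
     \sum_i f i (y i) <= S * M') ->
  pos_dual_bound (Z := dualL Z) r phi M ->
  \sum_i phi i (dabs (f i)) <= S * M.
Proof.
move=> S0 mf hphi hS hM.
apply: (cone_bidual_le (convex_cone_pos hL) (norm_pospart_sublinear hL) (@norm_pospart_ge0 R V L)
  (norm_pospart_le_norm hL) r1 S0 (g := fun i => dabs (f i))).
- by move=> i; apply: dual_abs_mem.
- move=> x M' px hx; apply: sum_dual_abs_le => // y yx.
  have hb : pos_weak_bound (Z := Z) r (fun i => abs (y i)) M'.
    move=> h mh nh ph; apply: le_trans (hx h (dual_linear_form mh) _); last first.
      exact: pos_dual_le_norm_pospart.
    apply: ler_lnorm => // i.
    have h0 : 0 <= h (abs (y i)) by apply: ph => //; exact: lat_abs_ge0.
    rewrite ger0_norm// ger0_norm; first exact: (dual_mono hL).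
    by apply: ph => //; exact: px.
  by apply: hS => //; exact: (pos_weak_bound_ge0 nsZ hb).
- by move=> i; have [] := hphi i.
- move=> i g g' mg mg' gg'; have [mp pp] := hphi i.
  by apply: (bidual_mono mp pp) => // x _ px; exact: gg'.
- move=> h lh hnu; have [mh nh ph] := linear_form_le_norm_pospart hL lh hnu.
  exact: hM.
Qed.

(** The norming coefficients [a i] can be taken nonnegative, as [phi (f i)] is. The norm of the sum
    of the [a i * f i] is computed on vectors of [Z], which turns the weak-star bound on [f] into a
    weak one. *)
Lemma pos_weak_bound_dual_abs (f g : 'I_n -> ns_car (dual Z)) M :
  (forall i, ns_mem (dual Z) (f i) /\ nl_pos (dualL Z) (f i)) ->
  (forall i, ns_mem (dual Z) (g i)) ->
  (forall i, dual_le Z (dabs (g i)) (f i)) -> 0 <= M ->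
  pos_dual_bound r f M ->
  pos_weak_bound (Z := dualL Z) r (fun i => dabs (g i)) M.
Proof.
move=> hf mg gf M0 hM phi mphi nphi pphi.
have mf i := (hf i).1; have pf i := (hf i).2.
apply: (@le_trans _ _ (lnorm r n (fun i => phi (f i)))).
  apply: ler_lnorm => // i.
  have h0 : 0 <= phi (dabs (g i)).
    by apply: pphi; [exact: dual_abs_mem | exact: dual_abs_ge0].
  have le : phi (dabs (g i)) <= phi (f i).
    by apply: bidual_mono => //; exact: dual_abs_mem.
  by rewrite ger0_norm// ger0_norm//; exact: le_trans le.
have [a [pa <- a0]] := exists_polar_eq (fun i => phi (f i)) r1.
have {}a0 i : 0 <= a i by apply: a0; exact: pphi.
rewrite -(dual_dual_sum a mphi mf).
set F := fun v => _.
have mF : ns_mem (dual Z) F by apply: dual_mem_sum => i; exact: dual_memZ.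
apply: (le_trans (ler_norm _)).
apply: (le_trans (iffLR (dual_norm_le1P (dual_ns_axioms nsZ) mphi) nphi F mF)).
apply: (dual_norm_le nsZ) => // y _.
rewrite /F; apply: (le_trans (ler_norm_sum _ _ _)).
apply: (@le_trans _ _ (M * `|abs y|)); last by rewrite lat_norm_abs.
apply: le_trans (pos_dual_bound_normr mf hM (lat_abs_ge0 hL y)).
apply: le_trans (pa _); apply: ler_sum => i _.
rewrite normrM ger0_norm// ler_wpM2l//.
by have := norm_le_dual_abs hL (mf i) y; rewrite (dual_abs_id hL).
Qed.

Lemma pos_dual_bound_dual_abs (g : 'I_n -> ns_car (dual Z)) M :
  pos_weak_bound (Z := dualL Z) r (fun i => dabs (g i)) M ->
  pos_dual_bound (Z := Z) r (fun i => dabs (g i)) M.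
Proof.
move=> h y my ny py; apply: (h (fun f => f y)).
- exact: (@eval_mem R Z).
- exact: (@eval_norm_le1 R Z).
- by move=> f mf pf; exact: pf.
Qed.

Lemma pos_dual_bound_eval (z : 'I_n -> V) M :
  pos_weak_bound (Z := Z) r z M ->
  pos_dual_bound (Z := dualL Z) r (fun i => fun f : ns_car (dualL Z) => f (z i)) M.
Proof. by move=> h f mf nf pf; exact: h. Qed.

Lemma eval_pos (z : V) : 0 <=l z ->
  ns_mem (dual (dual Z)) (fun f : ns_car (dual Z) => f z) /\
  nl_pos (dualL (dualL Z)) (fun f : ns_car (dual Z) => f z).
Proof. by move=> pz; split=> [|f _ pf]; [exact: (@eval_mem R Z) | exact: pf]. Qed.

(** For [r = 1] the conjugate exponent is [+oo]: [W] controls each functional separately on positive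
    vectors, and positive norming functionals attain the sum of the norms, so the convention agrees
    with the general formula. *)
Lemma pi_norm_nl_of_leP (z : 'I_n -> V) K : 0 <= K ->
  (pi_norm Z r z <= K%:E)%E <->
  forall (fs : 'I_n -> ns_car (dual Z)) W, 0 <= W ->
    (forall i, ns_mem (dual Z) (fs i) /\ nl_pos (dualL Z) (fs i)) ->
    pos_dual_bound (conj_exp r) fs W ->
    \sum_(i < n) fs i (abs (z i)) <= K * W.
Proof.
move=> K0; have [re|rn1] := eqVneq r 1%E; last first.
  exact: (pi_norm_leP (Z := Z) z (nl_of_axioms hL) r1 rn1 K0).
rewrite /pi_norm re eqxx /= eqxx lee_fin; split=> [h fs W W0 hfs hW|h].
  apply: (@le_trans _ _ (\sum_i W * `|z i|)); last first.
    by rewrite -mulr_sumr mulrC ler_wpM2r.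
  apply: ler_sum => i _; rewrite -(lat_norm_abs hL (z i)).
  have mfs j := (hfs j).1.
  have oo1 : (1 <= +oo :> \bar R)%E by exact: leey.
  have := @pos_dual_bound_norm R Z _ _ fs W (abs (z i)) nsZ oo1
    (fun a x => @lat_scale_ge0 R V L hL a x) mfs hW I (lat_abs_ge0 hL _).
  apply: le_trans; apply: (le_trans (ler_norm _)).
  exact: (@ler_norm_lnorm R +oo%E n (fun j => fs j (abs (z i))) i oo1).
have /choice[f hf] := fun i => exists_norming hL (z i).
have := h f 1 ler01; rewrite mulr1.
rewrite (eq_bigr (fun i => `|z i|)) => [|i _]; last by have [] := hf i.
apply=> [i|y my ny py]; first by have [] := hf i.
apply: bigmax_le => // i _; have [mf nf _ _] := hf i.
apply: (le_trans (iffLR (dual_norm_le1P nsZ mf) nf y my)); exact: ny.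
Qed.

End LatticeBidual.

(** * Families in the bidual of a Banach space *)

Section Bidual.
Local Set Implicit Arguments.
Local Unset Strict Implicit.
Context {R : realType} {V : normedModType R}.
Variables (n : nat) (r : \bar R).
Hypothesis r1 : (1 <= r)%E.
Local Notation Z := (ns_of V).

Let nsZ : ns_axioms Z. Proof. exact: ns_of_axioms. Qed.

(** With the whole space as cone, an inequality between linear forms is an equality, so the
    monotonicity that [cone_bidual_le] asks of [phi] is automatic. *)
Lemma sum_bidual_le (f : 'I_n -> V -> R) (phi : 'I_n -> ns_car (dual (dual Z))) S M :
  0 <= S -> (forall i, ns_mem (dual Z) (f i)) ->
  (forall i, ns_mem (dual (dual Z)) (phi i)) ->
  (forall y M', 0 <= M' -> weak_bound (S := Z) r y M' -> \sum_i f i (y i) <= S * M') ->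
  weak_bound (S := dual (dual Z)) r phi M ->
  \sum_i phi i (f i) <= S * M.
Proof.
move=> S0 mf mphi hS hM.
have cT : convex_cone (@setT V) by [].
have snu : sublinear (fun v : V => `|v|).
  by split=> [x y|a x a0]; rewrite ?ler_normD// normrZ ger0_norm.
apply: (cone_bidual_le cT snu (@normr_ge0 _ V) (fun=> lexx _) r1 S0) => //.
- move=> x M' _ hx.
  have hb : weak_bound (S := Z) r x M'.
    move=> h mh nh; apply: hx => [|v]; first exact: dual_linear_form.
    apply: (le_trans (ler_norm _)).
    exact: (iffLR (dual_norm_le1P nsZ mh) nh).
  by apply: hS => //; exact: (weak_bound_ge0 nsZ hb).
- move=> i g g' mg mg' gg'; rewrite (_ : g = g')//; apply/funext => v.
  apply/le_anti; rewrite gg'//= -lerN2.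
  rewrite -(linear_formN (dual_linear_form mg)) -(linear_formN (dual_linear_form mg')).
  exact: gg'.
- move=> h lh hnu.
  have mh : ns_mem (dual Z) h.
    by apply: (@linear_form_mem _ _ _ 1) => // v; rewrite mul1r.
  (* Evaluation at [h] lies in the unit ball of the third dual, so the weak bound on [phi] applies
     to it. *)
  apply: (hM (fun psi : ns_car (dual (dual Z)) => psi h)).
    exact: (eval_mem (dual_ns_axioms nsZ)).
  by apply: (eval_norm_le1 (dual_ns_axioms nsZ)) => //; exact: linear_form_norm_le1.
Qed.

(** A functional of norm at most 1 on the bidual, composed with the canonical embedding, is one on
    [V]; the embedding thus does not enlarge weak bounds. *)
Lemma weak_bound_eval (x : 'I_n -> V) M : weak_bound (S := Z) r x M ->
  weak_bound (S := dual (dual Z)) r (fun i => fun f : ns_car (dual Z) => f (x i)) M.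
Proof.
move=> hM Phi mPhi nPhi.
have dS := dual_ns_axioms nsZ; have ddS := dual_ns_axioms dS.
pose J (v : V) : ns_car (dual (dual Z)) := fun f => f v.
have mJ v : ns_mem (dual (dual Z)) (J v) by exact: (eval_mem nsZ).
have bPhi := iffLR (dual_norm_le1P ddS mPhi) nPhi.
(* Elements of the bidual are functions on all maps V -> R, so J is additive
   only up to elements of norm 0. *)
have lJ : linear_form (fun v => Phi (J v)).
  move=> a u v; rewrite -(mPhi.1 a _ _ (mJ u) (mJ v)).
  set w := ns_add _ _ _; have mw : ns_mem (dual (dual Z)) w.
    by apply: dual_memD => //; exact: dual_memZ.
  have mw' := dual_memZ (-1) mw.
  apply/eqP; rewrite -subr_eq0 -normr_eq0 -[- Phi w]mulN1r.
  rewrite -(dual_formZ ddS _ mPhi mw) -(dual_formD ddS mPhi (mJ _) mw').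
  apply/eqP/le_anti; rewrite normr_ge0 andbT.
  apply: (le_trans (bPhi _ (dual_memD (mJ _) mw'))).
  apply: (dual_norm_le dS) => // f mf; rewrite mul0r normr_le0 /w /J /=.
  by rewrite (dual_linear_form mf) mulN1r subrr.
have J1 v : `|Phi (J v)| <= `|v|.
  apply: (le_trans (bPhi _ (mJ v))); apply: (dual_norm_le dS) => // f mf.
  by rewrite mulrC; exact: (dual_norm_bound nsZ).
have J1' v : Phi (J v) <= `|v| by apply: le_trans (J1 v); exact: ler_norm.
apply: (hM (fun v => Phi (J v))); last exact: linear_form_norm_le1.
by apply: (@linear_form_mem _ _ _ 1) => // v; rewrite mul1r.
Qed.

End Bidual.

(** * Duality of the nuclear inequalities *)

Lemma weak_norm_ge0 {R : realType} (G : nspace R) r n (x : 'I_n -> ns_car G) :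
  ns_axioms G -> (0 <= weak_norm G r x)%E.
Proof.
move=> hG; apply: (@le_trans _ _ (lnorm r n (fun=> 0))%:E).
  by rewrite lee_fin lnorm_ge0.
apply: ereal_sup_ubound; exists (fun=> 0) => //; split; first exact: dual_mem0.
by apply: (dual_norm_le hG) => // y my; rewrite normr0 mul1r; exact: (ns_norm_ge0 hG).
Qed.

Lemma abs_weak_norm_ge0 {R : realType} (Z : nlattice R) r n (z : 'I_n -> ns_car Z) :
  ns_axioms Z -> (0 <= abs_weak_norm Z r z)%E.
Proof.
move=> hZ; apply: (@le_trans _ _ (lnorm r n (fun=> 0))%:E).
  by rewrite lee_fin lnorm_ge0.
apply: ereal_sup_ubound; exists (fun=> 0) => //.
split; [exact: dual_mem0 | | exact: dual_pos0].
by apply: (dual_norm_le hZ) => // y my; rewrite normr0 mul1r; exact: (ns_norm_ge0 hZ).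
Qed.

Section RealForms.
Local Set Implicit Arguments.
Local Unset Strict Implicit.
Context {R : realType} {p q : \bar R}.
Hypotheses (p1 : (1 <= p)%E) (q1 : (1 <= q)%E).

(** Common interface for two cases: on [dualL] it holds since the exponent is not 1, on [nl_of] by
    identifying the convention at exponent 1. *)
Definition pi_norm_spec (Z : nlattice R) (r : \bar R) : Prop :=
  forall n (z : 'I_n -> ns_car Z) K, 0 <= K ->
  (pi_norm Z r z <= K%:E)%E <->
  forall (fs : 'I_n -> ns_car (dual Z)) V, 0 <= V ->
    (forall i, ns_mem (dual Z) (fs i) /\ nl_pos (dualL Z) (fs i)) ->
    pos_dual_bound (conj_exp r) fs V ->
    \sum_(i < n) fs i (nl_abs Z (z i)) <= K * V.

Lemma left_pos_ineqP (Z : nlattice R) (H : nspace R) S C :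
  nl_axioms Z -> ns_axioms H -> 0 <= C ->
  left_pos_ineq Z H p q S C <->
  forall n (z : 'I_n -> ns_car Z) (fs : 'I_n -> ns_car (dual H)) M W,
    (forall i, ns_mem Z (z i)) -> (forall i, ns_mem (dual H) (fs i)) ->
    0 <= M -> 0 <= W ->
    pos_weak_bound q (fun i => nl_abs Z (z i)) M -> weak_bound (conj_exp p) fs W ->
    `|\sum_i fs i (S (z i))| <= C * M * W.
Proof.
move=> hZ hH C0; split=> h n z.
  move=> fs M W mz mfs M0 W0 hM hW; move: (h n z mz).
  rewrite (le_mule_abs_weak_normP _ hZ q1 C0 mz) => /(_ _ hM).
  by rewrite cohen_norm_leP// ?mulr_ge0//; apply.
move=> mz; rewrite (le_mule_abs_weak_normP _ hZ q1 C0 mz) => M hM.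
have M0 := pos_weak_bound_ge0 (nl_ns hZ) hM.
rewrite cohen_norm_leP// ?mulr_ge0// => fs W W0 mfs hW.
exact: h.
Qed.

Lemma right_pos_ineqP (G : nspace R) (W : nlattice R) S C :
  ns_axioms G -> pi_norm_spec W p -> 0 <= C ->
  right_pos_ineq G W p q S C <->
  forall n (x : 'I_n -> ns_car G) (fs : 'I_n -> ns_car (dual W)) M V,
    (forall i, ns_mem G (x i)) ->
    (forall i, ns_mem (dual W) (fs i) /\ nl_pos (dualL W) (fs i)) ->
    0 <= M -> 0 <= V ->
    weak_bound q x M -> pos_dual_bound (conj_exp p) fs V ->
    \sum_i fs i (nl_abs W (S (x i))) <= C * M * V.
Proof.
move=> hG hW C0; split=> h n x.
  move=> fs M V mx mfs M0 V0 hM hV; move: (h n x mx).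
  rewrite (le_mule_weak_normP _ hG q1 C0 mx) => /(_ _ hM).
  by rewrite hW// ?mulr_ge0//; apply.
move=> mx; rewrite (le_mule_weak_normP _ hG q1 C0 mx) => M hM.
have M0 := weak_bound_ge0 hG hM.
rewrite hW// ?mulr_ge0// => fs V V0 mfs hV.
exact: h.
Qed.

Lemma pos_ineqP (Z W : nlattice R) S C :
  nl_axioms Z -> pi_norm_spec W p -> 0 <= C ->
  pos_ineq Z W p q S C <->
  forall n (z : 'I_n -> ns_car Z) (fs : 'I_n -> ns_car (dual W)) M V,
    (forall i, ns_mem Z (z i)) ->
    (forall i, ns_mem (dual W) (fs i) /\ nl_pos (dualL W) (fs i)) ->
    0 <= M -> 0 <= V ->
    pos_weak_bound q (fun i => nl_abs Z (z i)) M ->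
    pos_dual_bound (conj_exp p) fs V ->
    \sum_i fs i (nl_abs W (S (z i))) <= C * M * V.
Proof.
move=> hZ hW C0; split=> h n z.
  move=> fs M V mz mfs M0 V0 hM hV; move: (h n z mz).
  rewrite (le_mule_abs_weak_normP _ hZ q1 C0 mz) => /(_ _ hM).
  by rewrite hW// ?mulr_ge0//; apply.
move=> mz; rewrite (le_mule_abs_weak_normP _ hZ q1 C0 mz) => M hM.
have M0 := pos_weak_bound_ge0 (nl_ns hZ) hM.
rewrite hW// ?mulr_ge0// => fs V V0 mfs hV.
exact: h.
Qed.

End RealForms.

(** Existence quantifies over all real [C], the norm over [C >= 0] only; stability under
    [Num.max C 0] reduces both claims to an equivalence for nonnegative constants. *)
Lemma exists_and_inf_transfer {R : realType} (P Q : R -> Prop) :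
  (forall C, P C -> P (Num.max C 0)) -> (forall C, Q C -> Q (Num.max C 0)) ->
  (forall C, 0 <= C -> P C <-> Q C) ->
  ((exists C, P C) <-> (exists C, Q C)) /\
  ereal_inf [set C%:E | C in [set C | 0 <= C /\ P C]] =
  ereal_inf [set C%:E | C in [set C | 0 <= C /\ Q C]].
Proof.
move=> Pmax Qmax PQ; split.
  split=> -[C hC]; exists (Num.max C 0); apply/PQ; rewrite ?le_max ?lexx ?orbT//;
    by [exact: Pmax | exact: Qmax].
congr (ereal_inf (_ @` _)); apply/seteqP; split=> C [C0 hC]; split=> //;
  exact/PQ.
Qed.

Lemma le_mule_max0 {R : realType} (a b : \bar R) (C : R) : (0 <= b)%E ->
  (a <= C%:E * b)%E -> (a <= (Num.max C 0)%:E * b)%E.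
Proof.
move=> b0 h; apply: (le_trans h); apply: lee_wpmul2r => //.
by rewrite lee_fin le_max lexx.
Qed.

(** * The inequalities for an operator and its adjoint *)

Section Duality.
Local Set Implicit Arguments.
Local Unset Strict Implicit.
Context {R : realType}.

Lemma adjoint_mem {V W : completeNormedModType R} (T : {linear V -> W}) f :
  continuous T -> ns_mem (dual (ns_of W)) f -> ns_mem (dual (ns_of V)) (f \o T).
Proof.
move=> cT mf.
have /linear_boundedP [c [_ hc]] := continuous_linear_bounded (0 : V) (cT 0).
have [d hd] : exists d, forall w, ns_mem (ns_of W) w -> `|f w| <= d * `|w| := mf.2.
split=> [a x y _ _ /=|]; first by rewrite linearP; exact: mf.1.
(* [linear_boundedP] bounds [T] by every constant strictly beyond [c], hence by [c + 1]. *)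
exists (`|d| * (c + 1)) => x _ /=; apply: (le_trans (hd _ I)).
apply: (@le_trans _ _ (`|d| * `|T x|)); first by rewrite ler_wpM2r// ler_norm.
by rewrite -mulrA ler_wpM2l// hc// ltrDl.
Qed.

Variables (p q : R).
Hypotheses (p1 : 1 <= p) (q1 : 1 <= q).

Let Ep : (1 <= p%:E)%E. Proof. by rewrite lee_fin. Qed.
Let Eq : (1 <= q%:E)%E. Proof. by rewrite lee_fin. Qed.
Let Ecp : (1 <= conj_exp p%:E)%E. Proof. exact: conj_exp_ge1. Qed.
Let Ecq : (1 <= conj_exp q%:E)%E. Proof. exact: conj_exp_ge1. Qed.

Section LatticeDomain.
Variables (X : completeNormedModType R) (LX : lat_data X).
Hypothesis hX : is_banach_lattice X LX.
Let nZ := nl_of_axioms hX.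
Let nZd := dualL_axioms hX.

Lemma pi_norm_spec_dualL : pi_norm_spec (dualL (nl_of X LX)) (conj_exp q%:E).
Proof. by move=> n z K K0; apply: pi_norm_leP => //; exact: conj_exp_neq1. Qed.

Lemma pi_norm_spec_nl_of : pi_norm_spec (nl_of X LX) p%:E.
Proof. by move=> n z K K0; apply: pi_norm_nl_of_leP. Qed.

(** Towards the adjoint, [sum_bidual_dual_abs_le] is used for the [f i \o T] with constant [C * M].
    Back, the adjoint is tested with evaluations at |z_i|, where the modulus of [f i \o T] dominates
    |f_i(T z_i)|. *)
Lemma left_pos_duality (F : completeNormedModType R) (T : {linear X -> F}) C :
  continuous T -> 0 <= C ->
  left_pos_ineq (nl_of X LX) (ns_of F) p%:E q%:E T C <->
  right_pos_ineq (dual (ns_of F)) (dualL (nl_of X LX))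
    (conj_exp q%:E) (conj_exp p%:E) (adjoint (ns_of X) (B := ns_of F) T) C.
Proof.
move=> cT C0; have nF := @ns_of_axioms R F; have nFd := dual_ns_axioms nF.
rewrite (left_pos_ineqP (Z := nl_of X LX) (H := ns_of F) Ep Eq T nZ nF C0).
rewrite (right_pos_ineqP Ecp _ nFd pi_norm_spec_dualL C0) conj_expK//.
split=> h n.
- move=> f phi M V mf hphi M0 V0 hM hV.
  apply: (sum_bidual_dual_abs_le hX Eq) => //.
  + by rewrite mulr_ge0.
  + by move=> i; exact: adjoint_mem.
  + move=> y M' M'0 hM'; apply: (le_trans (ler_norm _)); rewrite mulrAC.
    exact: (h n y f M' M).
- move=> z f M W mz mf M0 W0 hM hW.
  have mTf i := adjoint_mem cT (mf i).
  apply: (le_trans (ler_norm_sum _ _ _)).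
  rewrite mulrAC.
  apply: le_trans (h n f (fun i => fun g => g (ld_abs LX (z i))) W M mf _ W0 M0 hW _).
  + by apply: ler_sum => i _; exact: (norm_le_dual_abs hX (mTf i)).
  + by move=> i; apply: eval_pos; exact: lat_abs_ge0.
  + exact: pos_dual_bound_eval.
Qed.

(** Signed functionals on [Y] enter the inequality for [T] through their moduli; conversely [f i] at
    |T x_i| equals [g i (T (x i))] for some [g i] of modulus at most [f i], and the adjoint is
    applied to these [g i]. *)
Lemma pos_duality (Y : completeNormedModType R) (LY : lat_data Y)
    (T : {linear X -> Y}) C : is_banach_lattice Y LY -> pi_norm_spec (nl_of Y LY) p%:E ->
  continuous T -> 0 <= C ->
  pos_ineq (nl_of X LX) (nl_of Y LY) p%:E q%:E T C <->
  pos_ineq (dualL (nl_of Y LY)) (dualL (nl_of X LX))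
    (conj_exp q%:E) (conj_exp p%:E) (adjoint (nl_of X LX) (B := nl_of Y LY) T) C.
Proof.
move=> hY sY cT C0; have nYd := dualL_axioms hY.
rewrite (pos_ineqP (Z := nl_of X LX) (W := nl_of Y LY) Eq T nZ sY C0).
rewrite (pos_ineqP Ecp _ nYd pi_norm_spec_dualL C0) conj_expK//.
split=> h n.
- move=> g phi M V mg hphi M0 V0 hM hV.
  apply: (sum_bidual_dual_abs_le hX Eq) => //.
  + by rewrite mulr_ge0.
  + by move=> i; exact: adjoint_mem.
  + move=> y M' M'0 hM'; rewrite mulrAC.
    apply: le_trans (h n y (fun i => dual_abs (nl_of Y LY) (g i)) M' M _ _ M'0 M0 hM' _) => //.
    * apply: ler_sum => i _; apply: (le_trans (ler_norm _)).
      exact: (norm_le_dual_abs hY (mg i)).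
    * by move=> i; split; [exact: dual_abs_mem | exact: dual_abs_ge0].
    * exact: (pos_dual_bound_dual_abs (V := Y)).
- move=> x f M V mx hf M0 V0 hM hV.
  have /choice[g hg] := fun i => exists_dual_abs_le hY (T (x i)) (hf i).1 (hf i).2.
  have mg i : ns_mem (dual (nl_of Y LY)) (g i) by have [] := hg i.
  have mTg i := adjoint_mem cT (mg i).
  rewrite mulrAC.
  apply: le_trans (h n g (fun i => fun k => k (ld_abs LX (x i))) V M mg _ V0 M0 _ _).
  + apply: ler_sum => i _; have [_ /= <- _] := hg i.
    apply: (le_trans (ler_norm _)); exact: (norm_le_dual_abs hX (mTg i)).
  + by move=> i; apply: eval_pos; exact: lat_abs_ge0.
  + apply: (pos_weak_bound_dual_abs hY Ecp hf mg _ V0 hV) => i.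
    by have [] := hg i.
  + exact: pos_dual_bound_eval.
Qed.

End LatticeDomain.

Lemma right_pos_duality (E : completeNormedModType R) (Y : completeNormedModType R)
    (LY : lat_data Y) (T : {linear E -> Y}) C :
  is_banach_lattice Y LY -> pi_norm_spec (nl_of Y LY) p%:E ->
  continuous T -> 0 <= C ->
  right_pos_ineq (ns_of E) (nl_of Y LY) p%:E q%:E T C <->
  left_pos_ineq (dualL (nl_of Y LY)) (dual (ns_of E))
    (conj_exp q%:E) (conj_exp p%:E) (adjoint (ns_of E) (B := ns_of Y) T) C.
Proof.
move=> hY sY cT C0; have nYd := dualL_axioms hY; have nE := @ns_of_axioms R E.
have nEd := dual_ns_axioms nE.
rewrite (right_pos_ineqP (G := ns_of E) (W := nl_of Y LY) Eq T nE sY C0).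
rewrite (left_pos_ineqP Ecq Ecp _ nYd nEd C0) conj_expK//.
split=> h n.
- move=> g phi M W mg mphi M0 W0 hM hW.
  have mTg i := adjoint_mem cT (mg i).
  have hb y M' : 0 <= M' -> weak_bound (S := ns_of E) q%:E y M' ->
      `|\sum_i g i (T (y i))| <= C * M * M'.
    move=> M'0 hM'; rewrite mulrAC.
    apply: le_trans (h n y (fun i => dual_abs (nl_of Y LY) (g i)) M' M _ _ M'0 M0 hM' _) => //.
    * apply: (le_trans (ler_norm_sum _ _ _)).
      by apply: ler_sum => i _; exact: (norm_le_dual_abs hY (mg i)).
    * by move=> i; split; [exact: dual_abs_mem | exact: dual_abs_ge0].
    * exact: (pos_dual_bound_dual_abs (V := Y)).
  have CM0 : 0 <= C * M by rewrite mulr_ge0.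
  (* [sum_bidual_le] is one-sided, so it is applied both to the negatives of the [phi i] and to the
     [phi i]. *)
  rewrite ler_norml lerNl; apply/andP; split.
    have := @sum_bidual_le R E n q%:E Eq (fun i => g i \o T) (fun i f => -1 * phi i f) _ W CM0 mTg.
    rewrite -mulr_sumr mulN1r; apply.
    + by move=> i; apply: dual_memZ; exact: mphi.
    + by move=> y M' M'0 hM'; apply: le_trans (hb y M' M'0 hM'); exact: ler_norm.
    + move=> Phi mPhi nPhi.
      have -> : (fun i => Phi (fun f => -1 * phi i f)) = (fun i => -1 * Phi (phi i)).
        by apply/funext => i; exact: (dual_formZ (dual_ns_axioms nEd) (-1) mPhi (mphi i)).
      by rewrite lnormZ// normrN1 mul1r; exact: hW.
  apply: (sum_bidual_le Eq CM0 mTg mphi) => // y M' M'0 hM'.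
  by apply: le_trans (hb y M' M'0 hM'); exact: ler_norm.
- move=> x f M V mx hf M0 V0 hM hV.
  have /choice[g hg] := fun i => exists_dual_abs_le hY (T (x i)) (hf i).1 (hf i).2.
  have mg i : ns_mem (dual (nl_of Y LY)) (g i) by have [] := hg i.
  rewrite mulrAC.
  apply: le_trans (h n g (fun i => fun k => k (x i)) V M mg _ V0 M0 _ _).
  + apply: le_trans (ler_norm _); apply: ler_sum => i _.
    by have [_ /= <- _] := hg i.
  + by move=> i; exact: (eval_mem nE).
  + apply: (pos_weak_bound_dual_abs hY Ecp hf mg _ V0 hV) => i.
    by have [] := hg i.
  + exact: weak_bound_eval.
Qed.

End Duality.

Theorem theorem4p3 (R : realType) (p q : R) (hq1 : 1 <= q) (hqp : q <= p) :
  (* (1) T : X -> F, X Banach lattice, F Banach space *)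
  (forall (X : completeNormedModType R) (LX : lat_data X)
          (F : completeNormedModType R) (T : {linear X -> F}),
     is_banach_lattice X LX -> continuous T ->
     let Ts := adjoint (ns_of X) (B := ns_of F) T in
     (left_pos_cohen (nl_of X LX) (ns_of F) p%:E q%:E T <->
      right_pos_cohen (dual (ns_of F)) (dualL (nl_of X LX))
        (conj_exp q%:E) (conj_exp p%:E) Ts) /\
     left_pos_cohen_norm (nl_of X LX) (ns_of F) p%:E q%:E T =
      right_pos_cohen_norm (dual (ns_of F)) (dualL (nl_of X LX))
        (conj_exp q%:E) (conj_exp p%:E) Ts) /\
  (* (2) T : E -> Y, E Banach space, Y Banach lattice *)
  (forall (E : completeNormedModType R)
          (Y : completeNormedModType R) (LY : lat_data Y) (T : {linear E -> Y}),
     is_banach_lattice Y LY -> continuous T ->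
     let Ts := adjoint (ns_of E) (B := ns_of Y) T in
     (right_pos_cohen (ns_of E) (nl_of Y LY) p%:E q%:E T <->
      left_pos_cohen (dualL (nl_of Y LY)) (dual (ns_of E))
        (conj_exp q%:E) (conj_exp p%:E) Ts) /\
     right_pos_cohen_norm (ns_of E) (nl_of Y LY) p%:E q%:E T =
      left_pos_cohen_norm (dualL (nl_of Y LY)) (dual (ns_of E))
        (conj_exp q%:E) (conj_exp p%:E) Ts) /\
  (* (3) T : X -> Y, X and Y Banach lattices *)
  (forall (X : completeNormedModType R) (LX : lat_data X)
          (Y : completeNormedModType R) (LY : lat_data Y) (T : {linear X -> Y}),
     is_banach_lattice X LX -> is_banach_lattice Y LY -> continuous T ->
     let Ts := adjoint (nl_of X LX) (B := nl_of Y LY) T in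
     (pos_cohen (nl_of X LX) (nl_of Y LY) p%:E q%:E T <->
      pos_cohen (dualL (nl_of Y LY)) (dualL (nl_of X LX))
        (conj_exp q%:E) (conj_exp p%:E) Ts) /\
     pos_cohen_norm (nl_of X LX) (nl_of Y LY) p%:E q%:E T =
      pos_cohen_norm (dualL (nl_of Y LY)) (dualL (nl_of X LX))
        (conj_exp q%:E) (conj_exp p%:E) Ts).
Proof.
have hp1 : 1 <= p by exact: le_trans hqp.
have leftmax (Z : nlattice R) (H : nspace R) (a b : \bar R) S C : nl_axioms Z ->
    left_pos_ineq Z H a b S C -> left_pos_ineq Z H a b S (Num.max C 0).
  move=> nZ h n z mz; apply: le_mule_max0 (h n z mz).
  exact: (abs_weak_norm_ge0 _ _ _ _ (nl_ns nZ)).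
have rightmax (G : nspace R) (W : nlattice R) (a b : \bar R) S C : ns_axioms G ->
    right_pos_ineq G W a b S C -> right_pos_ineq G W a b S (Num.max C 0).
  by move=> nG h n x mx; apply: le_mule_max0 (h n x mx); exact: weak_norm_ge0.
have posmax (Z W : nlattice R) (a b : \bar R) S C : nl_axioms Z ->
    pos_ineq Z W a b S C -> pos_ineq Z W a b S (Num.max C 0).
  move=> nZ h n z mz; apply: le_mule_max0 (h n z mz).
  exact: (abs_weak_norm_ge0 _ _ _ _ (nl_ns nZ)).
split; [|split].
- move=> X LX F T hX cT Ts; apply: exists_and_inf_transfer => C.
  + exact/leftmax/(nl_of_axioms hX).
  + exact/rightmax/dual_ns_axioms/ns_of_axioms.
  + exact: left_pos_duality.
- move=> E Y LY T hY cT Ts; apply: exists_and_inf_transfer => C.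
  + exact/rightmax/ns_of_axioms.
  + exact/leftmax/(dualL_axioms hY).
  + by apply: right_pos_duality => //; exact: pi_norm_spec_nl_of.
- move=> X LX Y LY T hX hY cT Ts; apply: exists_and_inf_transfer => C.
  + exact/posmax/(nl_of_axioms hX).
  + exact/posmax/(dualL_axioms hY).
  + by apply: pos_duality => //; exact: pi_norm_spec_nl_of.
Qed.
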